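(* $$\mathrm{ex}(n,\mathbf A\mathbf D)=\begin{cases}\left\lfloor\frac14(n-1)^2\right\rfloor+2 & \text{if } n\ge4\text{ is even},\\[3pt] \frac14(n-1)^2 & \text{if } n \text{ is odd},\end{cases}$$ and a triple system $\mathcal F$ on $n$ vertices containing neither $\mathbf A$ nor $\mathbf D$ attains equality if and only if it is of the form $\mathcal F_T^+$ (for even $n\ge4$), respectively of one of the two forms $\mathcal F_T$ or $\mathcal F_T^{\pm}$ (for odd $n\ge5$), for a transitive tournament $T$.
   Context: A triple system on a finite vertex set $V$, $|V|=n$, is a family $\mathcal F$ of distinct $3$-element subsets (triples) of $V$. We write $123$ for $\{1,2,3\}$ etc. $\mathbf A=\{124,135,236\}$ (on 6 vertices) and $\mathbf D=\{123,134,235\}$ (on 5 vertices). A triple system contains a configuration if some of its triples form a system isomorphic to it (not necessarily induced). $\mathrm{ex}(n,X_1\dots X_k)$ denotes the maximum number of triples in a triple system on $n$ vertices that contains none of $X_1,\dots,X_k$. Tournament construction $\mathcal F_T$: take a maximum size matching (i.e. $\lfloor n/2\rfloor$ pairwise disjoint pairs) in the complete graph on the $n$-element vertex set, and a tournament $T$ whose vertices are these pairs. $\mathcal F_T$ consists of all triples $e\cup\{v\}$ where $e$ is a matching pair and $v$ belongs to another matching pair $e'$ such that $T$ has the arc $e\to e'$; and, if $n$ is odd, also all triples $e\cup\{u\}$ where $e$ is a matching pair and $u$ is the unique unmatched vertex. $T$ is transitive if its arc relation is a strict linear order. Let $T$ be transitive. For even $n\ge4$, let $12$ and $34$ be the matching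 pairs with the lowest and second lowest outdegree in $T$, respectively (so $\mathcal F_T$ contains $134,234$ on these four vertices); $\mathcal F_T^+:=\mathcal F_T\cup\{123,124\}$. For odd $n\ge5$, let $0$ be the unmatched vertex and let $12$ and $34$ be the matching pairs with the lowest and second lowest outdegree in $T$, respectively (so on these five vertices $\mathcal F_T$ contains exactly $012,034,134,234$); $\mathcal F_T^{\pm}:=(\mathcal F_T\setminus\{012,034\})\cup\{123,124\}$. *)

(* Defs.v *)
From mathcomp Require Import all_boot.

Set Implicit Arguments.
Unset Strict Implicit.
Unset Printing Implicit Defensive.

Definition triple_system (V : finType) (F : {set {set V}}) : bool :=
  [forall t in F, #|t| == 3].

Record config := Config {
  config_vertex : finType;
  config_triples : {set {set config_vertex}} }.

(* Not necessarily induced: F may have further triples on the image of f. *)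
Definition contains (V : finType) (F : {set {set V}}) (X : config) : bool :=
  [exists f : {ffun config_vertex X -> V},
    injectiveb f && [forall t in config_triples X, f @: t \in F]].

Definition avoids (V : finType) (F : {set {set V}}) (Xs : seq config) : bool :=
  all (fun X => ~~ contains F X) Xs.

Definition ex (n : nat) (Xs : seq config) : nat :=
  \max_(F : {set {set 'I_n}} | triple_system F && avoids F Xs) #|F|.

(* The vertices 1, ..., n+1 are encoded as 0, ..., n in 'I_n.+1. *)
Definition triple {n : nat} (i j k : nat) : {set 'I_n.+1} :=
  [set inord i.-1; inord j.-1; inord k.-1].

Definition confA : config :=
  @Config 'I_6 [set triple 1 2 4; triple 1 3 5; triple 2 3 6].

Definition confD : config :=
  @Config 'I_5 [set triple 1 2 3; triple 1 3 4; triple 2 3 5].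

Section TournamentConstruction.
Variable V : finType.
Implicit Types (M F : {set {set V}}) (T : rel {set V}) (p q e : {set V}).

Definition maximum_matching M : Prop :=
  [/\ {in M, forall e, #|e| = 2}, trivIset M & #|M| = #|V|./2].

(* Only the values of T on M matter. *)
Definition tournament M T : Prop :=
  {in M, irreflexive T} /\
  {in M &, forall e e', e != e' -> T e e' (+) T e' e}.

(* A tournament is irreflexive and total, so that transitivity makes its arc
   relation a strict linear order on M. *)
Definition transitive_tournament M T : Prop :=
  tournament M T /\ {in M & &, transitive T}.

(* The complement of cover M is empty if #|V| is even and consists of the
   unique unmatched vertex if #|V| is odd. *)
Definition FT M T : {set {set V}} :=
  [set v |: e | e in M, v in \bigcup_(e' in M | T e e') e']
  :|: [set u |: e | e in M, u in ~: cover M].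

Definition outdeg M T e : nat := #|[set e' in M | T e e']|.

Definition two_lowest M T p q : Prop :=
  [/\ p \in M, q \in M, p != q,
      {in M :\ p, forall e, outdeg M T p < outdeg M T e} &
      {in M :\: [set p; q], forall e, outdeg M T q < outdeg M T e}].

(* With p = 12 and q = 34, the family [set v |: p | v in q] is {123, 124}. *)
Definition FT_plus M T p q : {set {set V}} :=
  FT M T :|: [set v |: p | v in q].

Definition FT_pm M T (u : V) p q : {set {set V}} :=
  (FT M T :\: [set u |: p; u |: q]) :|: [set v |: p | v in q].

Definition of_form_FT F : Prop :=
  exists M T, [/\ maximum_matching M, transitive_tournament M T & F = FT M T].

Definition of_form_FT_plus F : Prop :=
  exists M T p q,
    [/\ maximum_matching M, transitive_tournament M T, two_lowest M T p q &
        F = FT_plus M T p q].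

Definition of_form_FT_pm F : Prop :=
  exists M T u p q,
    [/\ maximum_matching M, transitive_tournament M T, u \notin cover M,
        two_lowest M T p q & F = FT_pm M T u p q].

End TournamentConstruction.

(* Main.v *)
Require Import Defs.
From mathcomp Require Import all_boot zify.

(** Two triples through a common pair of vertices are tied together by the
    absence of D: a further triple sharing a pair with one of them contains
    the common pair, or all three lie on four vertices.  The triples linked by
    shared pairs thus form either a book, all of them containing one pair,
    the kernel, or a block of three or four triples on four vertices.

    The claimed value grows by n when two vertices are added to n vertices
    ([boundSS]).  The upper bound therefore follows by induction on the number
    n of vertices once two vertices are found that meet at most n - 2 triples;
    deleting them yields a system on n - 2
    vertices ([AD_extremal]).  If some pair meets fewer than n - 2 triples,
    then the bound is not attained.  Otherwise the system is called saturated,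
    and its structure is determined ([saturated_structure]):

    - Let {v, w} be a kernel.  Erasing v and w from the triples that contain
      exactly one of them leaves a multigraph on the vertices outside v, w and
      the pages of {v, w}.  The absence of A and D forces its components to be
      stars, triangles and doubled edges, so that it has at most as many edges
      as vertices ([charging_le]), and {v, w} meets at most n - 2 triples.  In
      the saturated case all its degrees are 2 ([charging_eq]), which excludes
      stars.  A doubled edge is itself a kernel and has more pages than
      {v, w} ([max_kernel_double]); a triangle spans a block, and
      then some pair of vertices meets too few triples.  A kernel with the largest number of pages
      is therefore completed to a triple by every other vertex
      ([max_kernel_spanning]).
    - Without kernels, all triples lie in blocks of four vertices.  Two blocks
      share at most one vertex, and the absence of A makes the outer
      neighbourhoods of the four vertices of a block disjoint.  Counting the
      triples that meet two vertices of the block leaves only a block and one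
      isolated vertex ([kernelless]).

    Reading the induction backwards, the extremal systems arise from a point,
    a complete block, or a complete block with an isolated point, by adding
    again and again a pair that forms a triple with every earlier vertex
    ([extremal]).  These are the systems of a transitive tournament, the added
    pairs being the matching, and each arc pointing to the pair added earlier
    ([extremal_form]).  Conversely such an addition creates neither A nor D
    ([AD_book]), which gives the lower bound, and the sizes of the tournament
    constructions follow by counting arcs ([FT_card]). *)

Set Implicit Arguments.
Unset Strict Implicit.
Unset Printing Implicit Defensive.

(** * Charging the edges of a multigraph to its vertices *)

Section Charging.
Variables (V : finType) (H : {set {set V}}) (W : {set V}).

(** The members of [H] are regarded as edges of a multigraph on [W], the edge
    of [t] being its trace on [W]; distinct members may have equal traces. *)
Definition hdeg (x : V) := #|[set t in H | x \in t]|.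

(** The weight that a vertex of the given degree sends to each of its edges.
    A vertex never sends out more than 2 in total. *)
Let share (x : V) := match hdeg x with 1 => 2 | 2 => 1 | _ => 0 end.

Hypothesis H2 : forall t, t \in H -> #|t :&: W| = 2.
Hypothesis Hd : forall t x y, t \in H -> x \in t -> y \in t -> x \in W ->
  y \in W -> x <> y -> 1 < hdeg x -> 1 < hdeg y -> hdeg x <= 2.

Lemma hdeg_gt0 t x : t \in H -> x \in t -> 0 < hdeg x.
Proof. by move=> tH xt; apply/card_gt0P; exists t; rewrite inE tH xt. Qed.

Lemma share_edge t : t \in H -> exists x y, [/\ x <> y, t :&: W = [set x; y] &
  \sum_(z in W | z \in t) share z = share x + share y].
Proof.
move=> tH; have /eqP/cards2P[x [y [xy tW]]] := H2 tH.
exists x, y; split=> //; first exact/eqP.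
rewrite (eq_bigl (mem [set x; y])); last by move=> z; rewrite -tW !inE andbC.
by rewrite big_setU1 ?inE //= big_set1.
Qed.

(** In a star the leaf pays for the edge; in a triangle and in a doubled edge
    both ends pay 1. *)
Lemma share_edge_ge2 t : t \in H -> 2 <= \sum_(z in W | z \in t) share z.
Proof.
move=> tH; have [x [y [xy tW ->]]] := share_edge tH.
have [] : x \in t :&: W /\ y \in t :&: W by rewrite tW !inE !eqxx orbT.
rewrite !inE => /andP[xt xW] /andP[yt yW].
have := hdeg_gt0 tH xt; have := hdeg_gt0 tH yt.
have := Hd tH xt yt xW yW xy; have := Hd tH yt xt yW xW (nesym xy).
rewrite /share; case: (hdeg x) => [|[|[|d]]]; case: (hdeg y) => [|[|[|d']]] //; lia.
Qed.

Lemma share_sum :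
  \sum_(t in H) \sum_(z in W | z \in t) share z = \sum_(z in W) hdeg z * share z.
Proof.
rewrite (exchange_big_dep (mem W)) /=; last by move=> t x _ /andP[].
apply: eq_bigr => x xW; rewrite -sum_nat_const.
by apply: eq_bigl => t; rewrite !inE xW.
Qed.

Lemma share_vertex x : hdeg x * share x <= 2.
Proof. by rewrite /share; case: (hdeg x) => [|[|[|d]]] //; rewrite muln0. Qed.

(** Every edge receives at least 2 and every vertex gives at most 2. *)
Lemma charging_le : #|H| <= #|W|.
Proof.
have h1 : \sum_(t in H) 2 <= \sum_(t in H) \sum_(z in W | z \in t) share z.
  by apply: leq_sum => t tH; apply: share_edge_ge2.
have h2 : \sum_(z in W) hdeg z * share z <= \sum_(z in W) 2.
  by apply: leq_sum => z _; apply: share_vertex.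
by move: h1 h2; rewrite share_sum !sum_nat_const; lia.
Qed.

(** In the case of equality every vertex gives exactly 2 and every edge
    receives exactly 2.  A vertex of degree 1 gives 2 to its only edge, whose
    other end gives at least 1 more. *)
Lemma charging_eq : #|W| <= #|H| -> forall x, x \in W -> hdeg x = 2.
Proof.
move=> WH.
have lb t0 : \sum_(t in H | t != t0) 2 <=
    \sum_(t in H | t != t0) \sum_(z in W | z \in t) share z.
  by apply: leq_sum => t /andP[tH _]; apply: share_edge_ge2.
have ub z0 : \sum_(z in W | z != z0) hdeg z * share z <=
    \sum_(z in W | z != z0) 2.
  by apply: leq_sum => z _; apply: share_vertex.
have d12 x : x \in W -> hdeg x = 1 \/ hdeg x = 2.
  move=> xW; have h0 : \sum_(t in H) 2 <= \sum_(z in W) hdeg z * share z.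
    by rewrite -share_sum; apply: leq_sum => t; apply: share_edge_ge2.
  have h1 : \sum_(z in W) 2 <= \sum_(t in H) 2 by rewrite !sum_nat_const; lia.
  move: (leq_trans h1 h0); rewrite [X in X <= _](bigD1 x) //= [X in _ <= X](bigD1 x) //=.
  have := ub x; rewrite /share.
  case: (hdeg x) => [|[|[|d]]]; rewrite ?muln0; lia.
move=> x xW; case: (d12 x xW) => // dx.
have /card_gt0P[t] : 0 < hdeg x by rewrite dx.
rewrite inE => /andP[tH xt].
have h0 : \sum_(t in H) \sum_(z in W | z \in t) share z <= \sum_(t in H) 2.
  rewrite share_sum; apply: (@leq_trans (\sum_(z in W) 2)).
    by apply: leq_sum => z _; apply: share_vertex.
  by rewrite !sum_nat_const; lia.
have [y [z [yz tW sE]]] := share_edge tH.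
have [] : y \in t :&: W /\ z \in t :&: W by rewrite tW !inE !eqxx orbT.
rewrite !inE => /andP[_ yW] /andP[_ zW].
have xyz : x = y \/ x = z.
  have : x \in t :&: W by rewrite inE xt.
  by rewrite tW !inE => /orP[]/eqP; [left|right].
have s3 : 3 <= share y + share z.
  move: (d12 y yW) (d12 z zW); rewrite /share.
  by case: xyz => <-; rewrite dx; [move=> _ [] -> | move=> [] ->].
move: h0; rewrite [X in X <= _](bigD1 t) //= [X in _ <= X](bigD1 t) //= sE.
by move/(leq_trans (leq_add s3 (lb t))); rewrite leq_add2r.
Qed.

End Charging.

(** * Triples and the two forbidden configurations *)

Definition triple_in (V : finType) (F : {set {set V}}) x y z := [set x; y; z] \in F.

Definition triangle_free (V : finType) (F : {set {set V}}) :=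
  forall a b c x y z, uniq [:: a; b; c; x; y; z] ->
    triple_in F a b x -> triple_in F a c y -> triple_in F b c z -> False.

Definition tight_path_free (V : finType) (F : {set {set V}}) :=
  forall a b c x y, uniq [:: a; b; c; x; y] ->
    triple_in F a b c -> triple_in F a c x -> triple_in F b c y -> False.

Ltac split_uniq :=
  rewrite /= !inE ?negb_or; repeat (apply/andP; split); try done; apply/eqP; congruence.

Section Edge.
Variables (V : finType) (F : {set {set V}}).
Implicit Types (t : {set V}).

Lemma edgeC x y z : triple_in F x y z = triple_in F y x z.
Proof. by rewrite /triple_in (setUC [set x]). Qed.

Lemma edgeA x y z : triple_in F x y z = triple_in F x z y.
Proof. by rewrite /triple_in -!setUA (setUC [set y]). Qed.

End Edge.

Ltac perm_edge := solve [ assumption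
  | rewrite edgeC; assumption | rewrite edgeA; assumption
  | rewrite edgeC edgeA; assumption | rewrite edgeA edgeC; assumption
  | rewrite edgeC edgeA edgeC; assumption ].

Lemma cards3 (V : finType) (x y z : V) : x <> y -> x <> z -> y <> z ->
  #|[set x; y; z]| = 3.
Proof.
move=> /eqP xy /nesym/eqP/negbTE zx /nesym/eqP/negbTE zy.
by rewrite setUC cardsU1 cards2 !inE zx zy xy.
Qed.

Section System.
Variables (V : finType) (S : {set V}) (F : {set {set V}}).
Hypothesis F3 : forall t, t \in F -> #|t| = 3.
Hypothesis FS : forall t, t \in F -> t \subset S.
Hypothesis noA : triangle_free F.
Hypothesis noD : tight_path_free F.
Implicit Types (t : {set V}).

Local Notation edge := (triple_in F).

Lemma edge_neq x y z : edge x y z -> [/\ x <> y, x <> z & y <> z].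
Proof.
have neq a b c : edge a b c -> a <> b.
  by move=> /F3 abc ab; move: abc; rewrite ab setUid cards2; case: eqP.
move=> xyz; split; first exact: neq xyz.
  by apply: (@neq _ _ y); perm_edge.
by apply: (@neq _ _ x); perm_edge.
Qed.

Lemma edge_in x y z : edge x y z -> [/\ x \in S, y \in S & z \in S].
Proof. by move=> /FS /subsetP s; split; apply: s; rewrite !inE eqxx ?orbT. Qed.

Lemma edge_of2 t x y : t \in F -> x \in t -> y \in t -> x <> y ->
  exists2 z, t = [set x; y; z] & edge x y z.
Proof.
move=> tF xt yt xy; have t3 := F3 tF.
have st : [set x; y] \subset t by apply/subsetP => u; rewrite !inE => /orP[]/eqP->.
have /cards1P[z zE] : #|t :\: [set x; y]| == 1.
  by rewrite cardsD (setIidPr st) t3 cards2; move/eqP: xy => ->.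
have tE : t = [set x; y; z] by rewrite -zE -[LHS](setID t [set x; y]) (setIidPr st).
by exists z => //; rewrite /triple_in -tE.
Qed.

Lemma edge_of t x : t \in F -> x \in t ->
  exists y z, t = [set x; y; z] /\ edge x y z.
Proof.
move=> tF xt; have : 0 < #|t :\ x| by have := cardsD1 x t; rewrite xt F3 //; lia.
case/card_gt0P=> y; rewrite !inE => /andP[/eqP yx yt].
by have [z tE e] := edge_of2 tF xt yt (nesym yx); exists y, z.
Qed.

(* Adds to the context the disequalities carried by its edges. *)
Ltac edge_dist := repeat match goal with
  | [ e : is_true (triple_in _ ?x ?y ?z) |- _ ] =>
      lazymatch goal with
      | [ _ : x <> y, _ : x <> z, _ : y <> z |- _ ] => fail
      | _ => have [? ? ?] := edge_neq e
      end
  end.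

Lemma no_triangle a b c x y z : edge a b x -> edge a c y -> edge b c z ->
  x <> c -> y <> b -> z <> a -> x <> y -> y <> z -> x <> z -> False.
Proof.
move=> e1 e2 e3 *; edge_dist; apply: (noA _ e1 e2 e3); split_uniq.
Qed.

(** Two triples that leave [abc] through different pairs lead to the same new
    vertex, since otherwise the three form a tight path. *)
Lemma tight a b c x y : edge a b c -> edge a c x -> edge b c y ->
  x <> b -> y <> a -> x = y.
Proof.
move=> e1 e2 e3 ? ?; apply/eqP/negPn/negP => /eqP ?.
edge_dist; apply: (noD _ e1 e2 e3); split_uniq.
Qed.


(** Three triples on four vertices cover all pairs of these vertices.  A triple
    that leaves the four vertices through one of the pairs would extend two of
    the three to a tight path. *)
Lemma K4_closed a b q r t : edge a b q -> edge a b r -> edge a q r -> q <> r ->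
  t \in F -> 1 < #|t :&: [set a; b; q; r]| -> t \subset [set a; b; q; r].
Proof.
move=> e1 e2 e3 qr tF /card_gt1P[x [y []]].
rewrite !in_setI => /andP[xt xB] /andP[yt yB] /eqP xy.
have [z tE e] := edge_of2 tF xt yt xy; edge_dist.
suff zB : z \in [set a; b; q; r].
  by rewrite tE; apply/subsetP => i; rewrite in_setU in_set2 in_set1 -orbA => /or3P[]/eqP->.
apply/negPn/negP; rewrite !inE !negb_or -!andbA => /and4P[/eqP za /eqP zb /eqP zq /eqP zr].
have T s s' s'' : edge a s s' -> edge a s s'' -> edge a s' s'' -> s' <> z -> s'' <> z ->
    (edge a s z -> False) /\ (edge s s' z -> False).
  move=> f1 f2 f3 sz' sz; edge_dist.
  by split=> f; edge_dist; case: sz; symmetry;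
    [apply: (@tight s s' a) | apply: (@tight s' a s)]; try perm_edge; congruence.
have [|||||nab nbq] := T b q r; try perm_edge; try congruence.
have [|||||naq nqr] := T q r b; try perm_edge; try congruence.
have [|||||nar nrb] := T r b q; try perm_edge; try congruence.
move: xB yB; rewrite !inE -!orbA.
by case/or4P=> /eqP ?; case/or4P=> /eqP ?; subst x y; try (by []);
  first [by apply: nab; perm_edge | by apply: naq; perm_edge | by apply: nar; perm_edge
   | by apply: nbq; perm_edge | by apply: nqr; perm_edge | by apply: nrb; perm_edge].
Qed.

(** * Kernels *)

Definition pages v w := [set p | edge v w p].

(** The kernel of a book.  In a triple that shares no pair with another one,
    each of the three pairs is a kernel with a single page. *)
Definition kernel v w := (pages v w != set0) &&
  [forall p, forall z, edge v w p ==>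
     (edge v p z ==> (z == w)) && (edge w p z ==> (z == v))].

Lemma kernelP v w : reflect ((exists p, edge v w p) /\
  forall p z, edge v w p ->
    (edge v p z -> z = w) /\ (edge w p z -> z = v)) (kernel v w).
Proof.
apply: (iffP andP) => [[/set0Pn[p]]|[[p vwp] h]].
  rewrite inE => vwp /forallP h; split; first by exists p.
  move=> q z vwq; have /forallP/(_ z)/implyP/(_ vwq)/andP[h1 h2] := h q.
  by split=> [/(implyP h1)/eqP|/(implyP h2)/eqP].
split; first by apply/set0Pn; exists p; rewrite inE.
apply/forallP=> q; apply/forallP=> z; apply/implyP=> vwq.
have [h1 h2] := h q z vwq.
by apply/andP; split; apply/implyP=> e; apply/eqP; auto.
Qed.

Lemma kernelC v w : kernel v w -> kernel w v.
Proof.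
move=> /kernelP[[p vwp] h]; apply/kernelP; split; first by exists p; perm_edge.
by move=> q z e; have [|h1 h2] := h q z; first perm_edge.
Qed.

Definition hit v w := [set t in F | (v \in t) || (w \in t)].
(** With [v] and [w] erased, these triples are the edges of the multigraph on
    [outer v w] to which the charging argument applies. *)
Definition hit1 v w := [set t in F | (v \in t) (+) (w \in t)].
Definition outer v w := S :\: ([set v; w] :|: pages v w).

Lemma pagesC v w : pages v w = pages w v.
Proof. by apply/setP => p; rewrite !inE edgeC. Qed.

Lemma hit1C v w : hit1 v w = hit1 w v.
Proof. by apply/setP => t; rewrite !inE addbC. Qed.

Lemma outerC v w : outer v w = outer w v.
Proof. by rewrite /outer pagesC (setUC [set v]). Qed.

Lemma outerP v w x : reflect [/\ x \in S, x <> v, x <> w & ~~ edge v w x] (x \in outer v w).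
Proof.
rewrite !inE !negb_or -!andbA; apply: (iffP and4P).
  by case=> /eqP ? /eqP ? ? ?; split.
by case=> ? /eqP ? /eqP ? ?; split.
Qed.

Lemma hit1P v w x t : t \in hit1 v w -> x \in t -> x <> v -> x <> w ->
  exists y, [/\ t = [set v; x; y], edge v x y & y <> w] \/
            [/\ t = [set w; x; y], edge w x y & y <> v].
Proof.
rewrite inE => /andP[tF tv] xt xv xw.
have [vt|vt] := boolP (v \in t); move: tv; rewrite ?vt ?(negbTE vt) /=.
  move=> wt; have [y tE e] := edge_of2 tF vt xt (nesym xv).
  by exists y; left; split=> // yw; move: wt; rewrite tE yw !inE eqxx orbT.
move=> wt; have [y tE e] := edge_of2 tF wt xt (nesym xw).
by exists y; right; split=> // yv; move: vt; rewrite tE yv !inE eqxx orbT.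
Qed.

Lemma kernel_neq v w : kernel v w -> v <> w.
Proof. by case/kernelP => -[p /edge_neq[]]. Qed.

(** An edge at [x] in the link of [v] and one in the link of [w] would form a
    loose triangle with a triple [vwp]. *)
Lemma kernel_cross v w x y z : kernel v w ->
  edge v x y -> edge w x z -> y <> w -> z <> v -> y = z.
Proof.
case/kernelP=> -[p vwp] h vxy wxz yw zv; edge_dist.
apply/eqP/negPn/negP => /eqP yz.
have px : p <> x by move=> px; subst x; have [/(_ vxy)] := h p y vwp.
have py : p <> y.
  by move=> py; subst y; have [] := h p x vwp; rewrite edgeA => /(_ vxy); congruence.
have pz : p <> z.
  move=> pz; subst z; have [_] := h p x vwp.
  by rewrite (edgeA _ w) => /(_ wxz); congruence.
by apply: (no_triangle vwp vxy wxz).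
Qed.

Lemma hdeg_gt1 (H : {set {set V}}) x t : 1 < hdeg H x ->
  exists t', [/\ t' \in H, x \in t' & t' <> t].
Proof.
case/card_gt1P=> t1 [t2 []]; rewrite !inE => /andP[t1H xt1] /andP[t2H xt2] /eqP t12.
have [e|/eqP ne] := eqVneq t1 t; last by exists t1.
by exists t2; split=> //; congruence.
Qed.

Lemma hdeg_le2 (H : {set {set V}}) x t1 t2 :
  (forall t, t \in H -> x \in t -> t = t1 \/ t = t2) -> hdeg H x <= 2.
Proof.
move=> h; apply: (@leq_trans #|[set t1; t2]|); last by rewrite cards2; case: (_ != _).
apply/subset_leq_card/subsetP => t; rewrite !inE => /andP[tH xt].
by case: (h t tH xt) => ->; rewrite eqxx ?orbT.
Qed.

(** If [xy] lies in both links, then by [kernel_cross] it is a doubled edge and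
    a component.  Otherwise only triples through [v] matter, and the link of
    [v] contains no path with three edges because of [tight]. *)
Lemma kernel_hdeg_aux v w x y : kernel v w -> edge v x y -> x <> w -> y <> w ->
  1 < hdeg (hit1 v w) y -> hdeg (hit1 v w) x <= 2.
Proof.
move=> k vxy xw yw dy; edge_dist.
have [wxy|/negP wxy] := boolP (edge w x y).
  apply: (@hdeg_le2 _ _ [set v; x; y] [set w; x; y]) => t tH xt.
  have [||a [[-> e aw]|[-> e av]]] := hit1P tH xt; try congruence.
    by left; rewrite (@kernel_cross v w x a y) //; congruence.
  by right; rewrite -(@kernel_cross v w x y a).
have [t' [t'H yt' t't]] := @hdeg_gt1 _ y [set v; x; y] dy.
have [||b [[t'E e bw]|[t'E e bv]]] := hit1P t'H yt'; try congruence; last first.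
  have xb : x = b by apply: (@kernel_cross v w y) => //; perm_edge.
  by case: wxy; rewrite xb; perm_edge.
have bx : b <> x by move=> bx; apply: t't; rewrite t'E bx -!setUA (setUC [set y]).
apply: (@hdeg_le2 _ _ [set v; x; y] [set v; x; b]) => t tH xt.
have [||a [[-> f aw]|[-> f av]]] := hit1P tH xt; try congruence; last first.
  have ya : y = a by apply: (@kernel_cross v w x).
  by case: wxy; rewrite ya; perm_edge.
have [->|/eqP ay] := eqVneq a y; [by left|right].
by rewrite (@tight x y v a b) //; perm_edge.
Qed.

Lemma kernel_edge_outer v w x y : kernel v w -> edge v x y -> x <> w -> y <> w ->
  x \in outer v w.
Proof.
move=> /kernelP[_ h] e xw yw; edge_dist.
apply/outerP; split=> //; first by have [] := edge_in e.
  congruence.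
by apply/negP=> vwx; have [/(_ e)] := h x y vwx.
Qed.

Lemma kernel_hit1_split v w t : kernel v w -> t \in hit1 v w ->
  exists x y, [/\ t :&: outer v w = [set x; y], x <> y &
    [/\ edge v x y, x <> w & y <> w] \/ [/\ edge w x y, x <> v & y <> v]].
Proof.
wlog vt : v w / v \in t => [th|].
  move=> k tH; have [vt|vt] := boolP (v \in t); first exact: th.
  have wt : w \in t by move: tH; rewrite inE (negbTE vt) => /andP[].
  have [|x [y [e xy h]]] := th w v wt (kernelC k); first by rewrite hit1C.
  by exists x, y; rewrite outerC; split=> //; tauto.
move=> k; rewrite inE vt => /andP[tF wt].
have [x [y [tE e]]] := edge_of tF vt; edge_dist.
have [xw yw] : x <> w /\ y <> w.
  by split=> zw; move: wt; rewrite tE zw !inE eqxx ?orbT.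
have xo := kernel_edge_outer k e xw yw.
have yo : y \in outer v w by apply: (@kernel_edge_outer v w y x) => //; perm_edge.
exists x, y; split=> //; last by left.
apply/setP => z; rewrite tE in_setI in_setU in_set2 in_set1 in_set2.
have [->|zx] := eqVneq z x; first by rewrite xo orbT.
have [->|zy] := eqVneq z y; first by rewrite yo orbT.
by rewrite !orbF; case: eqVneq => // ->; rewrite !inE eqxx.
Qed.

Lemma kernel_cap v w t : kernel v w -> t \in hit1 v w -> #|t :&: outer v w| = 2.
Proof.
by move=> k tH; have [x [y [-> /eqP xy _]]] := kernel_hit1_split k tH; rewrite cards2 xy.
Qed.

Lemma kernel_hdeg v w t x y : kernel v w -> t \in hit1 v w -> x \in t -> y \in t ->
  x \in outer v w -> y \in outer v w -> x <> y ->
  1 < hdeg (hit1 v w) x -> 1 < hdeg (hit1 v w) y -> hdeg (hit1 v w) x <= 2.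
Proof.
move=> k tH xt yt /outerP[_ xv xw _] /outerP[_ yv yw _] xy _ dy.
have [z [[tE e zw]|[tE e zv]]] := hit1P tH xt xv xw.
  have yz : y = z by move: yt; rewrite tE !inE -orbA => /or3P[] /eqP; congruence.
  subst z; exact: (@kernel_hdeg_aux v w x y k e xw yw dy).
have yz : y = z by move: yt; rewrite tE !inE -orbA => /or3P[] /eqP; congruence.
subst z; rewrite hit1C in dy *.
exact: (@kernel_hdeg_aux w v x y (kernelC k)).
Qed.

Lemma card_outer v w : kernel v w -> #|outer v w| + #|pages v w| + 2 = #|S|.
Proof.
move=> k; have [[p vwp] _] := kernelP _ _ k; have /eqP vw := kernel_neq k.
have sub : [set v; w] :|: pages v w \subset S.
  have [vS wS _] := edge_in vwp.
  by rewrite !subUset !sub1set vS wS; apply/subsetP=> q; rewrite inE => /edge_in[].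
rewrite -addnA addnC -(cardsID ([set v; w] :|: pages v w) S) (setIidPr sub).
congr (_ + _); rewrite cardsU cards2 vw.
suff -> : [set v; w] :&: pages v w = set0 by rewrite cards0; lia.
apply/setP=> q; rewrite !inE; apply/negP => /andP[/orP[]/eqP-> /edge_neq[]] //.
Qed.

Lemma hit_split v w : v <> w -> #|hit v w| <= #|pages v w| + #|hit1 v w|.
Proof.
move=> vw; apply: (@leq_trans #|[set [set v; w; p] | p in pages v w] :|: hit1 v w|); last first.
  rewrite cardsU (leq_trans (leq_subr _ _)) // leq_add2r; exact: leq_imset_card.
apply/subset_leq_card/subsetP => t; rewrite inE in_setU => /andP[tF vwt].
have [/andP[vt wt]|nvw] := boolP ((v \in t) && (w \in t)).
  by have [p tE e] := edge_of2 tF vt wt vw; apply/orP; left; apply/imsetP; exists p; rewrite ?inE.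
rewrite [t \in hit1 _ _]inE tF /=; move: nvw vwt.
by case: (v \in t); case: (w \in t); rewrite ?orbT.
Qed.

Lemma kernel_hit v w : kernel v w -> #|S| <= #|hit v w| + 2 ->
  #|hit v w| + 2 = #|S| /\ forall x, x \in outer v w -> hdeg (hit1 v w) x = 2.
Proof.
move=> k le; have c := card_outer k; have h := hit_split (kernel_neq k).
have d := charging_le (fun t => @kernel_cap v w t k) (fun t x y => @kernel_hdeg v w t x y k).
split; first lia.
apply: (charging_eq (fun t => @kernel_cap v w t k) (fun t x y => @kernel_hdeg v w t x y k)).
lia.
Qed.

(** * Saturated systems with a kernel *)

Section Saturated.
Hypothesis hits : forall v w, v \in S -> w \in S -> v <> w -> #|S| <= #|hit v w| + 2.

Lemma kernel_in v w : kernel v w -> v \in S /\ w \in S.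
Proof. by case/kernelP => -[p /edge_in[]]. Qed.

Lemma kernel_hdeg2 v w x : kernel v w -> x \in outer v w -> hdeg (hit1 v w) x = 2.
Proof.
move=> k; have [vS wS] := kernel_in k.
by have [_] := kernel_hit k (hits vS wS (kernel_neq k)); apply.
Qed.

Definition max_kernel v w :=
  kernel v w /\ forall v' w', kernel v' w' -> #|pages v' w'| <= #|pages v w|.

Lemma max_kernelC v w : max_kernel v w -> max_kernel w v.
Proof. by case=> k m; split; [apply: kernelC | rewrite pagesC]. Qed.

(** The pair [xy] has the pages [v] and [w].  If [xqz] is a triple through a
    page [q] with [z] different from [y], then [tight] makes [z] equal to every
    other page.  It cannot be both [v] and [w], and if [q] and [z] are these
    two, then [x] is a page of [vw], which the triple [vxy] excludes. *)
Lemma double_edge_kernel v w x y : kernel v w ->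
  edge v x y -> edge w x y -> kernel x y.
Proof.
move=> k vxy wxy; edge_dist; have vw := kernel_neq k.
have h x1 y1 q z : edge v x1 y1 -> edge w x1 y1 -> edge x1 y1 q -> edge x1 q z -> z = y1.
  move=> vxy1 wxy1 e1 e2; edge_dist; apply/eqP/negPn/negP => /eqP zy.
  have nx : ~~ edge v w x1.
    have : x1 \in outer v w by apply: (@kernel_edge_outer v w x1 y1); congruence.
    by case/outerP.
  have zr r : edge r x1 y1 -> r <> q -> z = r.
    by move=> rxy rq; apply: (@tight q y1 x1 z r) => //; perm_edge.
  have [qv|/eqP qv] := eqVneq q v.
    have zw : z = w by apply: zr => //; congruence.
    by case/negP: nx; subst q z; perm_edge.
  have zv : z = v by apply: zr => //; congruence.
  have [qw|/eqP qw] := eqVneq q w; last by apply: vw; rewrite -zv; apply: zr; congruence.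
  by case/negP: nx; subst q z; perm_edge.
apply/kernelP; split; first by exists v; perm_edge.
by move=> q z e; split=> e'; [apply: (@h x y q) | apply: (@h y x q)]; perm_edge.
Qed.

(** Saturation of the kernel [xy] leaves for [p] only two possibilities: being
    a page of [xy], or having degree 2 in the multigraph of [xy].  In the
    second case a triple through [p] and one of [x], [y] forms a loose triangle
    with [vwp] and [vxy]. *)
Lemma double_edge_pages v w x y p : kernel v w ->
  edge v x y -> edge w x y -> edge v w p -> edge x y p.
Proof.
move=> k vxy wxy vwp; edge_dist; have k' := double_edge_kernel k vxy wxy.
have aux x1 y1 z : kernel x1 y1 -> edge v x1 y1 -> edge w x1 y1 ->
    edge x1 p z -> z <> y1 -> p <> y1 -> False.
  move=> /kernelP[_ h] vxy1 wxy1 e zy py; edge_dist.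
  have nz r : edge r x1 y1 -> z <> r.
    move=> re rz; subst r; have [|h1 _] := h z p; first by perm_edge.
    by apply: py; apply: h1; perm_edge.
  have [zv zw] := (nz _ vxy1, nz _ wxy1).
  by apply: (@no_triangle p v x1 w z y1) => //; try perm_edge; congruence.
have /outerP[_ _ _ nx] : x \in outer v w by apply: (@kernel_edge_outer v w x y); congruence.
have /outerP[_ _ _ ny] : y \in outer v w.
  by apply: (@kernel_edge_outer v w y x); try perm_edge; congruence.
apply/negPn/negP => nxyp.
have po : p \in outer x y.
  apply/outerP; split=> //; first by have [] := edge_in vwp.
    by move=> px; rewrite -px vwp in nx.
  by move=> py; rewrite -py vwp in ny.
have /outerP[_ px py _] := po.
have : 0 < hdeg (hit1 x y) p by rewrite kernel_hdeg2.
case/card_gt0P=> t; rewrite inE => /andP[tH pt].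
have [//|//|z [[_ e zy]|[_ e zx]]] := hit1P tH pt.
  exact: (@aux x y z).
by apply: (@aux y x z) => //; [apply: kernelC | perm_edge | perm_edge].
Qed.

(** The kernel [xy] has all pages of [vw] and also [v], which contradicts
    maximality. *)
Lemma max_kernel_double v w x y : max_kernel v w -> edge v x y -> edge w x y -> False.
Proof.
move=> [k mx] vxy wxy.
have := mx _ _ (double_edge_kernel k vxy wxy); rewrite leqNgt => /negP; apply.
apply/proper_card/properP; split.
  by apply/subsetP=> p; rewrite !inE; apply: double_edge_pages.
exists v; first by rewrite inE; perm_edge.
by rewrite inE; apply/negP=> /edge_neq[].
Qed.

Definition link_triangle v x y z := [/\ edge v x y, edge v x z, edge v y z & y <> z].

(** All degrees are 2 and no edge is doubled, so the components of the
    multigraph are cycles within one link, and [tight] bounds their length. *)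
Lemma max_kernel_triangle v w x : max_kernel v w -> x \in outer v w ->
  exists y z, [/\ y <> w, z <> w & link_triangle v x y z] \/
              [/\ y <> v, z <> v & link_triangle w x y z].
Proof.
have aux v1 w1 x1 y z : max_kernel v1 w1 -> x1 <> w1 -> y <> w1 -> edge v1 x1 y -> edge v1 x1 z ->
    y <> z -> link_triangle v1 x1 y z.
  move=> m xw yw e1 e2 yz; have [k _] := m; split=> //; edge_dist.
  have yo : y \in outer v1 w1 by apply: (@kernel_edge_outer v1 w1 y x1) => //; perm_edge.
  have [t [tH yt tE]] : exists t, [/\ t \in hit1 v1 w1, y \in t & t <> [set v1; x1; y]].
    by apply: hdeg_gt1; rewrite kernel_hdeg2.
  have [||c [[tE' e cw]|[tE' e cv]]] := hit1P tH yt; try congruence.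
    have cx : c <> x1 by move=> cx; apply: tE; rewrite tE' cx -!setUA (setUC [set y]).
    by rewrite (@tight x1 y v1 z c) //; try perm_edge; congruence.
  have xc : x1 = c by apply: (@kernel_cross v1 w1 y) => //; perm_edge.
  by case: (@max_kernel_double v1 w1 x1 y m) => //; subst c; perm_edge.
move=> m xo; have [k _] := m; have /outerP[xS xv xw nx] := xo.
have d2 : 1 < hdeg (hit1 v w) x by rewrite kernel_hdeg2.
have [t1 [t1H xt1 _]] := hdeg_gt1 set0 d2.
have [t2 [t2H xt2 t12]] := hdeg_gt1 t1 d2.
have [//|//|a [[t1E e1 aw]|[t1E e1 av]]] := hit1P t1H xt1;
have [//|//|b [[t2E e2 bw]|[t2E e2 bv]]] := hit1P t2H xt2.
- exists a, b; left; split=> //; apply: (@aux _ w) => //.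
  by move=> ab; apply: t12; rewrite t1E t2E ab.
- have ab : a = b by apply: (@kernel_cross v w x).
  by case: (@max_kernel_double v w x a m) => //; subst b.
- have ab : b = a by apply: (@kernel_cross v w x).
  by case: (@max_kernel_double v w x a m) => //; subst b.
exists a, b; right; split=> //; apply: (@aux _ v) => //; first exact: max_kernelC.
by move=> ab; apply: t12; rewrite t1E t2E ab.
Qed.

Lemma K4_fourth a b q r u u' z : edge a b q -> edge a b r -> edge a q r -> q <> r ->
  u \in [set a; b; q; r] -> u' \in [set a; b; q; r] -> edge u u' z ->
  z \in [set a; b; q; r].
Proof.
move=> e1 e2 e3 qr uB u'B e; edge_dist.
have /subsetP : [set u; u'; z] \subset [set a; b; q; r].
  apply: (@K4_closed a b q r) => //; apply/card_gt1P; exists u, u'.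
  by split; rewrite ?in_setI ?uB ?u'B ?andbT ?in_setU ?in_set1 ?eqxx ?orbT //; apply/eqP.
by apply; rewrite !inE eqxx !orbT.
Qed.

(** A triple [xab] that leaves the block of the triangle meets it only in [x].
    Its other vertices are not pages and do not lie in triangles of the link of
    [v], since both would produce loose triangles through [v].  So [a] and [b]
    lie in triangles of the link of [w]: in the same triangle they give a tight
    path, in different ones a loose triangle. *)
Lemma link_triangle_touch v w x y z t : max_kernel v w -> x \in outer v w ->
  link_triangle v x y z -> y <> w -> z <> w -> t \in F -> x \in t ->
  t \subset [set v; x; y; z].
Proof.
move=> m xo [vxy vxz vyz yz] yw zw tF xt; have [k _] := m.
have /outerP[_ xv xw nx] := xo; have vw := kernel_neq k.
apply/negPn/negP => tB.
have fourth u u' s := @K4_fourth v x y z u u' s vxy vxz vyz yz.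
have B4 : [/\ v \in [set v; x; y; z], x \in [set v; x; y; z],
   y \in [set v; x; y; z] & z \in [set v; x; y; z]] by rewrite !inE !eqxx !orbT.
have [vB xB yB zB] := B4.
have wB : w \notin [set v; x; y; z].
  by rewrite !inE !negb_or -!andbA; apply/and4P; split; apply/eqP; congruence.
set B := [set v; x; y; z] in fourth tB vB xB yB zB wB B4.
have [a [b [tE e]]] := edge_of tF xt.
have aB : a \notin B.
  apply/negP => aB; case/negP: tB; rewrite tE.
  by rewrite !subUset !sub1set xB aB (@fourth x a b).
have bB : b \notin B.
  apply/negP => bB; case/negP: tB; rewrite tE.
  by rewrite !subUset !sub1set xB bB andbT (@fourth x b a) //; perm_edge.
have ne u u' : u \in B -> u' \notin B -> u' <> u.
  by move=> uB u'B uu'; rewrite uu' uB in u'B.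
have [av ax ay az] : [/\ a <> v, a <> x, a <> y & a <> z] by split; apply: ne.
have [bv bx by' bz] : [/\ b <> v, b <> x, b <> y & b <> z] by split; apply: ne.
have nout c d : edge x c d -> c \notin B -> d \notin B -> [/\ c <> w & ~~ edge v w c].
  move=> f cB dB.
  have [cv cx cy cz] : [/\ c <> v, c <> x, c <> y & c <> z] by split; apply: ne.
  have [dv dx dy dz] : [/\ d <> v, d <> x, d <> y & d <> z] by split; apply: ne.
  have cross s s' : s <> v -> edge x w s -> edge v x s' -> s' <> w -> s = s'.
    move=> h1 h2 h3 h4; symmetry.
    by apply: (@kernel_cross v w x) => //; perm_edge.
  split.
    by move=> cw; subst c; apply: dy; apply: cross.
  have dw : d <> w.
    by move=> dw; subst d; apply: cy; apply: cross => //; perm_edge.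
  apply/negP=> vwc; apply: (@no_triangle v c x w y d) => //; try perm_edge; congruence.
have [aw na] := nout a b e aB bB.
have [bw nb] : b <> w /\ ~~ edge v w b by apply: (nout b a) => //; perm_edge.
have [_ aS bS] := edge_in e.
have ao : a \in outer v w by apply/outerP.
have bo : b \in outer v w by apply/outerP.
have two (c1 c2 d : V) : c1 <> c2 -> c1 <> d \/ c2 <> d.
  by move=> cc; have [c1d|/eqP] := eqVneq c1 d; [right; congruence | left].
have vnot c d c' : edge x c d -> c \notin B -> d \notin B -> edge v c c' -> c' <> d -> False.
  move=> f cB dB f' c'd.
  have [cv cx cy cz] : [/\ c <> v, c <> x, c <> y & c <> z] by split; apply: ne.
  have [dv dx dy dz] : [/\ d <> v, d <> x, d <> y & d <> z] by split; apply: ne.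
  have c'B s : s \in B -> s <> v -> c' <> s.
    move=> sB sv c's; subst s; case/negP: cB; apply: (@fourth v c') => //; perm_edge.
  have c'x := c'B x xB xv; have c'y : c' <> y by apply: c'B => //; edge_dist; congruence.
  by apply: (@no_triangle v c x c' y d) => //; try perm_edge; congruence.
have wtri c d : edge x c d -> c \notin B -> d \notin B -> c \in outer v w ->
    exists c1 c2, c1 <> v /\ c2 <> v /\ link_triangle w c c1 c2.
  move=> f cB dB co; have [c1 [c2 [[c1w c2w T]|[c1v c2v T]]]] := max_kernel_triangle m co.
    have [T1 T2 _ c12] := T; case: (two c1 c2 d c12) => h.
      by case: (vnot c d c1).
    by case: (vnot c d c2).
  by exists c1, c2.
have wx c : edge w x c -> c <> v -> False.
  move=> f cv; have yc : y = c by apply: (@kernel_cross v w x).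
  by apply: (@max_kernel_double v w x y) => //; rewrite yc.
have [a1 [a2 [a1v [a2v [A1 A2 _ a12]]]]] := wtri a b e aB bB ao.
have [|b1 [_ [b1v [_ [B1 _ _ _]]]]] := wtri b a _ bB aB bo; first by perm_edge.
have wx' c c' : edge w c c' -> c <> v -> c' <> x.
  by move=> f cv c'x; subst c'; apply: (wx c) => //; perm_edge.
have [wab|/negP wab] := boolP (edge w a b).
  have [g [gb gv wag]] : exists g, [/\ g <> b, g <> v & edge w a g].
    by case: (two a1 a2 b a12) => h; [exists a1 | exists a2].
  have xg : x = g by apply: (@tight b w a); try perm_edge; congruence.
  by apply: (wx' a g).
have [g [gb gv wag]] : exists g, [/\ g <> b1, g <> v & edge w a g].
  by case: (two a1 a2 b1 a12) => h; [exists a1 | exists a2].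
have gx := wx' a g wag av; have b1x := wx' b b1 B1 bv.
have b1a : b1 <> a by move=> h; apply: wab; subst b1; perm_edge.
have gb' : g <> b by move=> h; apply: wab; subst g.
by apply: (@no_triangle w a b g b1 x) => //; try perm_edge; congruence.
Qed.

(** Otherwise the link of [v], say, contains a triangle [xyz].  Only triples of
    the block [vxyz] meet [x] or [y], at most four, so saturation leaves at
    most six vertices.  For a page [p] of [vw], a triple that meets [w] or [p]
    then avoids [x], [y] and [z] and has at most three vertices to choose
    from, so there is only one, too few for saturation. *)
Lemma max_kernel_spanning v w : max_kernel v w -> outer v w = set0.
Proof.
wlog [x [y [z [xo yw zw T]]]] : v w / exists x y z,
    [/\ x \in outer v w, y <> w, z <> w & link_triangle v x y z].
  move=> th m; apply/eqP/negPn/negP => /set0Pn[x xo].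
  have no v1 w1 x1 y z : max_kernel v1 w1 -> x1 \in outer v1 w1 -> y <> w1 -> z <> w1 ->
      link_triangle v1 x1 y z -> False.
    move=> m1 xo1 yw zw T; have e := th v1 w1 (ex_intro _ x1 (ex_intro _ y (ex_intro _ z
      (And4 xo1 yw zw T)))) m1.
    by rewrite e inE in xo1.
  have [y [z [[yw zw T]|[yv zv T]]]] := max_kernel_triangle m xo.
    exact: (no v w x y z).
  by apply: (no w v x y z (max_kernelC m) _ yv zv T); rewrite outerC.
move=> m; have [k _] := m; have [vxy vxz vyz yz] := T; edge_dist.
have /outerP[xS xv xw nx] := xo; have vw := kernel_neq k.
have [vS wS] := kernel_in k; have [_ _ zS] := edge_in vxz; have [_ _ yS] := edge_in vxy.
have yo : y \in outer v w by apply: (@kernel_edge_outer v w y x) => //; perm_edge.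
have zo : z \in outer v w by apply: (@kernel_edge_outer v w z x) => //; perm_edge.
have touch t : t \in F -> x \in t \/ y \in t \/ z \in t -> t \subset [set v; x; y; z].
  move=> tF [xt|[yt|zt]]; first exact: (@link_triangle_touch v w x y z).
    have -> : [set v; x; y; z] = [set v; y; x; z].
      by rewrite -(setUA _ [set x]) (setUC [set x]) setUA.
    apply: (@link_triangle_touch v w y x z) => //; split=> //; perm_edge.
  have -> : [set v; x; y; z] = [set v; z; x; y].
    by apply/setP => i; rewrite !inE; do 4 case: (i == _).
  by apply: (@link_triangle_touch v w z x y) => //; split=> //; perm_edge.
have cB : #|[set v; x; y; z]| <= 4.
  by rewrite setUC cardsU1 setUC cardsU1 cardsU1 cards1; do 3 case: (_ \notin _).
have le4 : #|hit x y| <= 4.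
  apply: (@leq_trans #|[set t : {set V} | t \subset [set v; x; y; z] & #|t| == 3]|).
    apply/subset_leq_card/subsetP => t; rewrite !inE => /andP[tF xyt].
    by rewrite F3 // eqxx touch //; case/orP: xyt => ?; [left | right; left].
  by rewrite cards_draws; case: #|[set v; x; y; z]| cB => [|[|[|[|[|?]]]]].
have c3 : #|[set x; y; z]| = 3.
  by apply: cards3; congruence.
have sub3 : [set x; y; z] \subset S by rewrite !subUset !sub1set xS yS.
have s6 := hits xS yS ltac:(done).
have [p vwp] : exists p, edge v w p by have [] := kernelP _ _ k.
have [_ _ pS] := edge_in vwp.
have wnp : w <> p by have [] := edge_neq vwp.
have := hits wS pS wnp.
have out r : r \in [set x; y; z] -> r <> w /\ r <> p.
  rewrite !inE -orbA => h; have : r \in outer v w by case/or3P: h => /eqP->.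
  by case/outerP=> _ _ rw nr; split=> // rp; rewrite rp vwp in nr.
have : #|hit w p| <= 1.
  rewrite -(cards1 (S :\: [set x; y; z])).
  apply/subset_leq_card/subsetP => t; rewrite inE in_set1 => /andP[tF wpt].
  rewrite eqEcard (F3 tF) cardsD (setIidPr sub3) c3; apply/andP; split.
    apply/subsetP=> i it; rewrite in_setD (subsetP (FS tF)) // andbT.
    apply/negP=> ixyz; have /subsetP tB : t \subset [set v; x; y; z].
      apply: touch => //; move: ixyz; rewrite !inE -orbA.
      by case/or3P=> /eqP<-; [left | right; left | right; right].
    have [_ /nesym pv _] := edge_neq vwp; have wv := nesym vw.
    have nB r : r \in [set v; x; y; z] -> r <> v -> r \in [set x; y; z].
      by rewrite !inE -!orbA => /or4P[] /eqP-> //; rewrite eqxx ?orbT.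
    case/orP: wpt => /tB /nB h.
      by have [] := out w (h wv).
    by have [] := out p (h pv).
  by move: s6 le4; clear; lia.
have := subset_leq_card sub3; rewrite c3; have := F3 vwp.
have : #|[set v; x; y; z]| <= #|S|.
  by apply/subset_leq_card; rewrite -!setUA subUset sub1set vS setUA.
have -> : [set v; x; y; z] = v |: [set x; y; z] by rewrite !setUA.
have -> : #|v |: [set x; y; z]| = 4.
  rewrite cardsU1 c3 !inE !negb_or.
  have -> : v != x by apply/eqP; congruence.
  have -> : v != y by apply/eqP; congruence.
  by have -> : v != z by apply/eqP; congruence.
clear; lia.
Qed.

(** * Saturated systems without kernels *)

Section Kernelless.
Hypothesis no_kernel : forall v w, ~~ kernel v w.

Lemma not_kernel v w p : edge v w p -> exists p' z, edge v w p' /\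
  ([/\ edge v p' z & z <> w] \/ [/\ edge w p' z & z <> v]).
Proof.
move=> e; have := no_kernel v w; rewrite negb_and negbK => /orP[/eqP p0|].
  have : p \in pages v w by rewrite inE.
  by rewrite p0 inE.
case/forallPn => p' /forallPn[z]; rewrite negb_imply negb_and !negb_imply.
case/andP=> e' h; exists p', z; split=> //.
by case/orP: h => /andP[? /eqP ?]; [left | right].
Qed.

(** Since no pair is a kernel, some pair [ab] has two pages.  As [ab] is not a
    kernel either, a triple leaves it through a page [q], and [tight] forces it
    to end in another page. *)
Lemma K4_exists v w p : edge v w p ->
  exists a b q r, [/\ edge a b q, edge a b r, edge a q r & q <> r].
Proof.
move=> e; have [a [b [s [s' [ss' abs abs']]]]] : exists a b s s',
    [/\ s <> s', edge a b s & edge a b s'].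
  have [p' [z [e1 [[e2 zw]|[e2 zv]]]]] := not_kernel e.
    by exists v, p', w, z; split; [congruence | perm_edge | perm_edge].
  by exists w, p', v, z; split; [congruence | perm_edge | perm_edge].
have [q [z [abq h]]] := not_kernel abs.
have [r [rq abr]] : exists r, r <> q /\ edge a b r.
  by have [sq|/eqP sq] := eqVneq s q; [exists s'; split => //; congruence | exists s].
edge_dist; case: h => -[e2 zn].
  have zr : z = r by apply: (@tight q b a); try perm_edge; congruence.
  by exists a, b, q, r; split=> //; [rewrite -zr | congruence].
have zr : z = r by apply: (@tight q a b); try perm_edge; congruence.
by exists b, a, q, r; split; [perm_edge | perm_edge | rewrite -zr | congruence].
Qed.

Section Block.
Variable B : {set V}.
Hypothesis BS : B \subset S.
Hypothesis B4 : #|B| = 4.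
Hypothesis B_closed : forall t, t \in F -> 1 < #|t :&: B| -> t \subset B.
Hypothesis B_cover : forall u u', u \in B -> u' \in B -> u <> u' ->
  exists2 c, c \in B & edge u u' c.

(** The triples that leave the block [B] at [u], and the vertices they reach. *)
Definition stubs u := [set t in F | t :&: B == [set u]].
Definition nbrs u := [set z in S :\: B | [exists y, edge u z y]].

Lemma block_third u u' z : u \in B -> u' \in B -> edge u u' z -> z \in B.
Proof.
move=> uB u'B e; have [/eqP uu' _ _] := edge_neq e.
have /subsetP : [set u; u'; z] \subset B.
  apply: B_closed => //; apply/card_gt1P; exists u, u'.
  by rewrite !inE uB u'B !eqxx !orbT.
by apply; rewrite !inE eqxx !orbT.
Qed.

Lemma stubsP u t : u \in B -> t \in stubs u -> exists x y,
  [/\ t = [set u; x; y], edge u x y, x \notin B & y \notin B].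
Proof.
move=> uB; rewrite inE => /andP[tF /eqP tB].
have : u \in t :&: B by rewrite tB inE.
rewrite inE uB andbT => ut; have [x [y [tE e]]] := edge_of tF ut.
have [ux uy xy] := edge_neq e.
exists x, y; split=> //; apply/negP => zB.
  have : x \in t :&: B by rewrite tE !inE eqxx orbT zB.
  by rewrite tB inE => /eqP; congruence.
have : y \in t :&: B by rewrite tE !inE eqxx orbT zB.
by rewrite tB inE => /eqP; congruence.
Qed.

Lemma stub_cap u t : u \in B -> t \in stubs u -> #|t :&: nbrs u| = 2.
Proof.
move=> uB tH; have [x [y [-> e xB yB]]] := stubsP uB tH.
have [ux uy xy] := edge_neq e; have [_ xS yS] := edge_in e.
have -> : [set u; x; y] :&: nbrs u = [set x; y].
  apply/setP=> i; rewrite in_setI in_setU in_set2 in_set1 in_set2.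
  have [->|iu] := eqVneq i u.
    rewrite !inE uB /=; move/eqP/negbTE: ux => ->; by move/eqP/negbTE: uy => ->.
  have [->|ix] := eqVneq i x; first by rewrite !inE xB xS; apply/existsP; exists y.
  have [->|iy] := eqVneq i y => //.
  by rewrite !inE yB yS; apply/existsP; exists x; perm_edge.
by rewrite cards2; move/eqP: xy => ->.
Qed.

(** In the link of [u], a path with three edges is excluded by [tight]. *)
Lemma stub_hdeg u t x y : u \in B -> t \in stubs u -> x \in t -> y \in t ->
  x \in nbrs u -> y \in nbrs u -> x <> y ->
  1 < hdeg (stubs u) x -> 1 < hdeg (stubs u) y -> hdeg (stubs u) x <= 2.
Proof.
move=> uB tH xt yt; rewrite !inE => /andP[/andP[xB _] _] /andP[/andP[yB _] _] xy _ dy.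
have other s i : s \in stubs u -> i \in s -> i \notin B ->
    exists2 j, s = [set u; i; j] & edge u i j.
  move=> sH is_ iB; have sF : s \in F by move: sH; rewrite inE => /andP[].
  apply: edge_of2 => //; last by move=> ui; rewrite -ui uB in iB.
  by have [x' [y' [-> _ _ _]]] := stubsP uB sH; rewrite !inE eqxx.
have [z tE e] := other t x tH xt xB.
have zy : z = y.
  move: yt; rewrite tE !inE -orbA => /or3P[] /eqP; try congruence.
  by move=> yu; rewrite yu uB in yB.
subst z; have [t' [t'H yt' t't]] := hdeg_gt1 t dy.
have [b t'E e'] := other t' y t'H yt' yB.
have bx : b <> x by move=> bx; apply: t't; rewrite t'E tE bx -!setUA (setUC [set y]).
apply: (@hdeg_le2 _ _ t [set u; x; b]) => s sH xs.
have [a sE f] := other s x sH xs xB.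
have [ay|/eqP ay] := eqVneq a y; first by left; rewrite sE tE ay.
by right; rewrite sE (@tight x y u a b) //; perm_edge.
Qed.

Lemma stubs_le u : u \in B -> #|stubs u| <= #|nbrs u|.
Proof.
move=> uB; apply: charging_le; first by move=> t; apply: stub_cap.
by move=> t x y; apply: stub_hdeg.
Qed.

Lemma nbrs_ge2 u : u \in B -> 0 < #|stubs u| -> 1 < #|nbrs u|.
Proof.
move=> uB /card_gt0P[t tH]; rewrite -(stub_cap uB tH).
by apply/subset_leq_card/subsetIr.
Qed.

(** Two triples [uzy] and [u'zy'] with [y] and [y'] distinct form a loose
    triangle with a triple of the block through [u] and [u'].  If [y] and [y']
    coincide, then [zy] has the pages [u] and [u'], and the only way for [zy]
    not to be a kernel is a triple that meets the block in [u] and [u'],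
    but such a triple is contained in the block. *)
Lemma nbrs_disjoint u u' : u \in B -> u' \in B -> u <> u' -> [disjoint nbrs u & nbrs u'].
Proof.
move=> uB u'B uu'; apply/pred0P => z /=; apply/negP; rewrite !inE.
case/andP=> /andP[/andP[zB _] /existsP[y e]] /andP[_ /existsP[y' e']].
have nB i j : edge i z j -> i \in B -> j \notin B.
  move=> f iB; apply/negP => jB; case/negP: zB.
  by apply: (@block_third i j) => //; perm_edge.
have [yB y'B] := (nB _ _ e uB, nB _ _ e' u'B).
have ne s i : s \in B -> i \notin B -> s <> i by move=> sB iB si; rewrite -si sB in iB.
have [c cB uc] := B_cover uB u'B uu'.
have [yy'|/eqP yy'] := eqVneq y y'; last first.
  by apply: (no_triangle uc e e') => //; try (by apply: ne); try (by apply/nesym; apply: ne).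
subst y'; have zyu : edge z y u by perm_edge.
have [p [x [zyp h]]] := not_kernel zyu; edge_dist.
have aux z1 y1 : z1 \notin B -> edge z1 y1 u -> edge z1 y1 u' -> edge z1 y1 p ->
    edge z1 p x -> x <> y1 -> False.
  move=> z1B f1 f2 f3 f4 xy; edge_dist.
  have xr r : edge z1 y1 r -> r <> p -> x = r.
    by move=> g rp; edge_dist; apply: (@tight p y1 z1); try perm_edge; congruence.
  case/negP: z1B; apply: (@block_third u u') => //.
  have [pu|/eqP pu] := eqVneq p u.
    have := xr u' f2; move=> h'; rewrite pu in h' f4; rewrite -h'; [perm_edge|congruence].
  have xu := xr u f1 (nesym pu).
  have [pu'|/eqP pu'] := eqVneq p u'; first by subst x p; perm_edge.
  by case: uu'; rewrite -xu; apply: xr => //; congruence.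
by case: h => -[e2 xn]; [apply: (@aux z y) | apply: (@aux y z)] => //; perm_edge.
Qed.

Lemma hit_block u u' : u \in B -> u' \in B -> u <> u' ->
  #|hit u u'| <= 4 + #|stubs u| + #|stubs u'|.
Proof.
move=> uB u'B uu'.
have -> : 4 = #|[set t : {set V} | t \subset B & #|t| == 3]| by rewrite cards_draws B4.
apply: (@leq_trans #|([set t : {set V} | t \subset B & #|t| == 3] :|: stubs u) :|: stubs u'|).
  apply/subset_leq_card/subsetP => t; rewrite in_set => /andP[tF].
  have st i : i \in B -> i \in t -> t \subset B \/ t \in stubs i.
    move=> iB it; have [h|h] := ltnP 1 #|t :&: B|; first by left; apply: B_closed.
    right; rewrite inE tF /= eq_sym eqEcard cards1 h andbT.
    by apply/subsetP => j; rewrite inE => /eqP->; rewrite inE it.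
  rewrite 2!in_setU [t \in [set t0 | _]]in_set (F3 tF) eqxx andbT.
  by case/orP=> [/(st _ uB)|/(st _ u'B)] [] ->; rewrite ?orbT.
rewrite cardsU (leq_trans (leq_subr _ _)) // leq_add2r.
by rewrite cardsU (leq_trans (leq_subr _ _)).
Qed.

Lemma nbrs_sum : \sum_(u in B) #|nbrs u| + 4 <= #|S|.
Proof.
rewrite -B4 -(cardsID B S) (setIidPr BS) addnC leq_add2l.
under eq_bigr => u _ do rewrite -sum1_card.
rewrite (exchange_big_dep (mem (S :\: B))) /=; last first.
  by move=> u z _; rewrite inE => /andP[].
rewrite -sum1_card; apply: leq_sum => z _; rewrite sum1dep_card.
apply/card_le1_eqP => u u'; rewrite in_set => /andP[uB zu]; rewrite in_set => /andP[u'B zu'] .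
apply/eqP/negPn/negP => /eqP uu'.
by have := disjointFr (nbrs_disjoint u'B uB uu') zu'; rewrite zu.
Qed.

End Block.

(** Two vertices of a block meet at most four triples inside and their stubs
    outside, while the stubs of all four vertices number at most |S| - 4,
    and a vertex with a stub has at least two neighbours outside.  Saturation for the six pairs of the block then forces |S| to be at most 6.
    If |S| = 6, then the two vertices outside the block form a kernel. *)
Lemma kernelless : 5 <= #|S| -> exists B : {set V},
  [/\ B \subset S, #|B| = 4, #|S| = 5 & forall t, t \in F -> t \subset B].
Proof.
move=> S5; have /card_gt1P[u1 [u2 [u1S u2S /eqP u12]]] : 1 < #|S| by apply: leq_trans S5.
have /card_gt0P[t0] : 0 < #|hit u1 u2|.
  by move: (hits u1S u2S u12) S5; clear; lia.
rewrite inE => /andP[t0F u12t].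
have [v [w [p e]]] : exists v w p, edge v w p.
  case/orP: u12t => ut; have [w [p [_ e]]] := edge_of t0F ut; first by exists u1, w, p.
  by exists u2, w, p.
have [a [b [q [r [e1 e2 e3 qr]]]]] := K4_exists e.
have [ab aq bq] := edge_neq e1; have [_ ar br] := edge_neq e2.
have [aS bS qS] := edge_in e1; have [_ _ rS] := edge_in e2.
have closed t := @K4_closed a b q r t e1 e2 e3 qr.
have BE : [set a; b; q; r] = a |: (b |: [set q; r]) by rewrite !setUA.
have abqr : (a \notin b |: [set q; r]) && (b \notin [set q; r]).
  by rewrite !inE !negb_or; do !(apply/andP; split); apply/eqP.
have [nab nbq] := andP abqr.
have [aB bB qB rB] : [/\ a \in [set a; b; q; r], b \in [set a; b; q; r],
   q \in [set a; b; q; r] & r \in [set a; b; q; r]] by rewrite !inE !eqxx !orbT.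
have B4 : #|[set a; b; q; r]| = 4.
  by rewrite BE cardsU1 nab cardsU1 nbq cards2; move/eqP: qr => ->.
have BS : [set a; b; q; r] \subset S by rewrite !subUset !sub1set aS bS qS rS.
have cover u u' : u \in [set a; b; q; r] -> u' \in [set a; b; q; r] -> u <> u' ->
    exists2 c, c \in [set a; b; q; r] & edge u u' c.
  rewrite !inE -!orbA; case/or4P=> /eqP->; case/or4P=> /eqP-> // _;
   first [ by exists a; [rewrite !inE !eqxx ?orbT | perm_edge]
         | by exists b; [rewrite !inE !eqxx ?orbT | perm_edge]
         | by exists q; [rewrite !inE !eqxx ?orbT | perm_edge]
         | by exists r; [rewrite !inE !eqxx ?orbT | perm_edge]].
set B := [set a; b; q; r] in closed BE aB bB qB rB B4 BS cover.
have third u u' z := @block_third B closed u u' z.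
have [S5'|] := eqVneq #|S| 5.
  exists B; split=> // t tF; apply: closed => //.
  have := subset_leq_card (setSD B (FS tF)); rewrite !cardsD (setIidPr BS) F3 // S5' B4.
  by clear; lia.
move/eqP=> S5'; exfalso.
have S6 : 6 <= #|S| by move: S5 S5'; clear; lia.
have [S6'|] := eqVneq #|S| 6; last first.
  move/eqP=> S6'.
  have bound u u' : u \in B -> u' \in B -> u <> u' -> #|S| <= 6 + #|stubs B u| + #|stubs B u'|.
    move=> uB u'B uu'.
    have h := hit_block B4 closed uB u'B uu'.
    have h' := hits (subsetP BS _ uB) (subsetP BS _ u'B) uu'.
    by move: h h'; clear; lia.
  have st u : u \in B -> #|stubs B u| <= #|nbrs B u| /\
      (0 < #|stubs B u| -> 1 < #|nbrs B u|).
    by move=> uB; split; [apply: stubs_le | apply: nbrs_ge2].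
  have sum4 : #|nbrs B a| + (#|nbrs B b| + (#|nbrs B q| + #|nbrs B r|)) + 4 <= #|S|.
    have := nbrs_sum BS B4 closed cover.
    by rewrite BE big_setU1 //= big_setU1 //= big_setU1 ?inE ?big_set1 //=; apply/eqP.
  (* The pairs ab and qr together give n <= 8.  For n = 7 or 8 at most one
     vertex of the block has no stub, which makes at least 6 neighbours. *)
  have arith n ha hb hq hr na nb nq nr :
      na + (nb + (nq + nr)) + 4 <= n -> n <= 6 + ha + hb -> n <= 6 + ha + hq ->
      n <= 6 + ha + hr -> n <= 6 + hb + hq -> n <= 6 + hb + hr -> n <= 6 + hq + hr ->
      ha <= na /\ (0 < ha -> 1 < na) -> hb <= nb /\ (0 < hb -> 1 < nb) ->
      hq <= nq /\ (0 < hq -> 1 < nq) -> hr <= nr /\ (0 < hr -> 1 < nr) ->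
      6 <= n -> n <> 6 -> False by clear; lia.
  exact: (arith _ _ _ _ _ _ _ _ _ sum4 (bound a b aB bB ab) (bound a q aB qB aq)
    (bound a r aB rB ar) (bound b q bB qB bq) (bound b r bB rB br) (bound q r qB rB qr)
    (st a aB) (st b bB) (st q qB) (st r rB) S6 S6').
have /eqP/cards2P[f [g [fg SB]]] : #|S :\: B| = 2 by rewrite cardsD (setIidPr BS) B4 S6'.
have inS i : i \in S -> i \in B \/ i = f \/ i = g.
  move=> iS; have [iB|iB] := boolP (i \in B); [by left | right].
  have : i \in S :\: B by rewrite inE iB.
  by rewrite SB !inE => /orP[]/eqP; [left | right].
have [fS gS] : f \in S :\: B /\ g \in S :\: B by rewrite SB !inE !eqxx orbT.
move: fS gS; rewrite !in_setD => /andP[fB fS] /andP[gB gS].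
move/eqP: fg => fg.
(* All triples that meet {f, g} contain f and g, because two of their
   vertices in B would place them inside B. *)
have ker u z f1 g1 : (forall i, i \in S -> i \in B \/ i = f1 \/ i = g1) -> f1 \notin B ->
    edge f1 g1 u -> edge f1 u z -> u \in B -> z = g1.
  move=> inS1 fB1 h1 h2 uB; have [_ _ zS] := edge_in h2.
  case: (inS1 z zS) => [zB|[zf|//]]; last by have [_] := edge_neq h2; congruence.
  by case/negP: fB1; apply: (third u z) => //; perm_edge.
have /card_gt0P[t] : 0 < #|hit f g| by move: (hits fS gS fg) S6; clear; lia.
rewrite inE => /andP[tF fgt].
have page u : edge f g u -> u \in B.
  move=> h; have [_ fu gu] := edge_neq h; have [_ _ uS] := edge_in h.
  by case: (inS u uS) => [//|[]]; congruence.
have [u fgu] : exists u, edge f g u.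
  have h f1 g1 : (forall i, i \in S -> i \in B \/ i = f1 \/ i = g1) -> f1 \notin B -> f1 \in t ->
      exists u, edge f1 g1 u.
    move=> inS1 f1B f1t; have [x [y [tE h]]] := edge_of tF f1t.
    have [fx fy xy] := edge_neq h; have [_ xS yS] := edge_in h.
    case: (inS1 x xS) => [xB|[|xg]]; [|congruence|by exists y; rewrite -xg].
    case: (inS1 y yS) => [yB|[|yg]]; [|congruence|by exists x; rewrite -yg; perm_edge].
    by case/negP: f1B; apply: (third x y) => //; perm_edge.
  case/orP: fgt => [/(h f g inS fB)|/(h g f _ gB)] //.
  case=> [i /inS|u gfu]; first by tauto.
  by exists u; perm_edge.
case/negP: (no_kernel f g); apply/kernelP; split; first by exists u.
move=> u' z h; have u'B := page u' h; split=> h'.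
  exact: (ker u' z f g).
apply: (ker u' z g f) => //; last by perm_edge.
by move=> i /inS; tauto.
Qed.

End Kernelless.

Lemma saturated_structure : 5 <= #|S| ->
  (exists v w, kernel v w /\ outer v w = set0) \/
  (exists B : {set V},
    [/\ B \subset S, #|B| = 4, #|S| = 5 & forall t, t \in F -> t \subset B]).
Proof.
move=> S5; have [/existsP[[v0 w0] k0]|nk] := boolP [exists vw, kernel vw.1 vw.2].
  left; case: (@arg_maxnP _ (v0, w0) (fun vw => kernel vw.1 vw.2)
    (fun vw => #|pages vw.1 vw.2|) k0) => -[v w] k mx.
  exists v, w; split=> //; apply: max_kernel_spanning; split=> // v' w' k'.
  exact: (mx (v', w')).
right; apply: kernelless => // v w; apply/negP=> k; case/negP: nk.
by apply/existsP; exists (v, w).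
Qed.


End Saturated.

End System.

(** * The upper bound by deleting pairs of vertices *)

Section Extremal.
Variable V : finType.
Implicit Types (S e : {set V}) (F : {set {set V}}).

Definition AD_system S F := [/\ forall t, t \in F -> #|t| = 3,
  forall t, t \in F -> t \subset S, triangle_free F & tight_path_free F].

Definition triples S := [set t : {set V} | t \subset S & #|t| == 3].
Definition book e S := [set v |: e | v in S].

(** The maximum for all positive n other than 2, where the formula overshoots. *)
Definition bound n := (n - 1) ^ 2 %/ 4 + (if odd n then 0 else 2).

Lemma boundSS n : 0 < n -> bound n.+2 = bound n + n.
Proof.
case: n => // n _; rewrite /bound /= negbK.
have -> : (n.+3 - 1) ^ 2 = n.+1 * 4 + (n.+1 - 1) ^ 2 by rewrite !subSS !subn0; clear; nia.
by rewrite divnMDl //; case: (~~ odd n); clear; lia.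
Qed.

(** The extremal systems together with their vertex sets.  The pair [e] in the
    last case is the source of the tournament. *)
Inductive extremal : {set V} -> {set {set V}} -> Prop :=
| Extremal_point u : extremal [set u] set0
| Extremal_block S : #|S| = 4 -> extremal S (triples S)
| Extremal_block_point S u : #|S| = 4 -> u \notin S -> extremal (u |: S) (triples S)
| Extremal_book e S F : #|e| = 2 -> [disjoint e & S] -> extremal S F ->
    extremal (e :|: S) (book e S :|: F).

Lemma card_triples S : #|triples S| = 'C(#|S|, 3).
Proof. exact: cards_draws. Qed.

Lemma AD_sub_triples S S' F : AD_system S F -> (forall t, t \in F -> t \subset S') ->
  F \subset triples S'.
Proof. by case=> F3 _ _ _ h; apply/subsetP=> t tF; rewrite inE h // F3. Qed.

Lemma AD_systemW S S' F F' : F' \subset F -> (forall t, t \in F' -> t \subset S') ->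
  AD_system S F -> AD_system S' F'.
Proof.
move=> /subsetP sF h [F3 _ noA noD]; split=> //.
- by move=> t /sF /F3.
- by move=> a b c x y z u e1 e2 e3; apply: (noA _ _ _ _ _ _ u); apply: sF.
- by move=> a b c x y u e1 e2 e3; apply: (noD _ _ _ _ _ u); apply: sF.
Qed.

Lemma AD_system_unhit S F v w : AD_system S F ->
  AD_system (S :\: [set v; w]) (F :\: hit F v w).
Proof.
move=> AD; apply: AD_systemW (AD); first exact: subsetDl.
move=> t; rewrite !inE => /andP[h tF]; have [_ /(_ _ tF) tS _ _] := AD.
apply/subsetP => i it; rewrite !inE (subsetP tS) // andbT.
move: h; rewrite tF /= negb_or => /andP[vt wt].
by rewrite negb_or; apply/andP; split; apply: contraTneq it => ->.
Qed.

Lemma card_unhit F v w : #|F| = #|F :\: hit F v w| + #|hit F v w|.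
Proof.
rewrite -(cardsID (hit F v w) F) addnC; congr (_ + _); apply: eq_card => t.
by rewrite !inE; case: (t \in F).
Qed.

Lemma kernel_book S F v w : AD_system S F -> kernel F v w -> outer S F v w = set0 ->
  hit F v w = book [set v; w] (S :\: [set v; w]).
Proof.
move=> [F3 FS noA noD] k o0; have vw := kernel_neq F3 k.
apply/setP=> t; apply/idP/imsetP => [th|[x]].
  have tF : t \in F by move: th; rewrite inE => /andP[].
  have t1 : t \notin hit1 F v w.
    by apply/negP => /(kernel_cap F3 FS k); rewrite o0 setI0 cards0.
  have [vt wt] : v \in t /\ w \in t.
    by move: t1 th; rewrite !inE tF; do 2 case: (_ \in t).
  have [x tE e] := edge_of2 F3 tF vt wt vw; exists x; last by rewrite tE setUC.
  have [_ vx wx] := edge_neq F3 e; have [_ _ xS] := edge_in FS e.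
  by rewrite !inE xS andbT negb_or; apply/andP; split; apply/eqP => h; congruence.
rewrite !inE negb_or => /andP[/andP[/eqP xv /eqP xw] xS] ->.
have vwx : triple_in F v w x.
  by apply/negPn/negP => n; have : x \in outer S F v w by [apply/outerP]; rewrite o0 inE.
by rewrite setUC -[_ \in F]/(triple_in F v w x) vwx !inE eqxx.
Qed.

Lemma card_pair_setD S v w : v \in S -> w \in S -> v <> w -> #|S :\: [set v; w]| = #|S| - 2.
Proof.
move=> vS wS /eqP vw; rewrite cardsD (setIidPr _) ?cards2 ?vw //.
by rewrite subUset !sub1set vS wS.
Qed.

(** Induction by deletion of two vertices, starting from at most four vertices,
    where all triples are allowed.  For two vertices the bound is not sharp,
    which is why the description of equality begins with three. *)
Lemma AD_extremal S F : 0 < #|S| -> AD_system S F -> #|F| <= bound #|S| /\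
  (2 < #|S| -> #|F| = bound #|S| -> extremal S F).
Proof.
move: {2}(#|S|) (leqnn #|S|) => n; elim: n S F => [|n IH] S F; first by case: #|S|.
move=> Sn S0 AD; have [F3 FS noA noD] := AD.
have FT : F \subset triples S := AD_sub_triples AD FS.
have := subset_leq_card FT; rewrite card_triples => Fle.
have [S5|] := ltnP 4 #|S|; last first.
  case E: #|S| S0 Fle => [|[|[|[|[|]]]]] // _ Fle _.
  - by split=> //; apply: leq_trans Fle _.
  - split=> // _ F1; have FE : F = triples S.
      by apply/eqP; rewrite eqEcard FT card_triples F1 E.
    have /set0Pn[u uS] : S != set0 by rewrite -card_gt0 E.
    have Su : #|S :\ u| = 2 by have := cardsD1 u S; rewrite uS E; clear; lia.
    (* The single triple is a point with one pair added. *)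
    have -> : F = book (S :\ u) [set u] :|: set0.
      apply/esym/eqP; rewrite setU0 eqEcard /book imset_set1 cards1 F1 andbT sub1set FE.
      by rewrite setD1K // inE subxx E.
    rewrite -{1}(setD1K uS) setUC; apply: Extremal_book => //; last exact: Extremal_point.
    by rewrite disjoint_sym disjoints1 !inE eqxx.
  split=> // _ F4; have -> : F = triples S; last exact: Extremal_block.
  by apply/eqP; rewrite eqEcard FT card_triples F4 E.
have peel v w : v \in S -> w \in S -> v <> w ->
    #|F :\: hit F v w| <= bound (#|S| - 2) /\
    (#|F :\: hit F v w| = bound (#|S| - 2) -> extremal (S :\: [set v; w]) (F :\: hit F v w)).
  move=> vS wS vw; have c := card_pair_setD vS wS vw.
  have [||| h1 h2] := IH (S :\: [set v; w]) (F :\: hit F v w).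
  - by rewrite c; move: Sn S5; clear; lia.
  - by rewrite c; move: S5; clear; lia.
  - exact: AD_system_unhit.
  by rewrite -c; split=> //; apply: h2; rewrite c; move: S5; clear; lia.
have bS : bound #|S| = bound (#|S| - 2) + (#|S| - 2).
  have {1}-> : #|S| = (#|S| - 2).+2 by move: S5; clear; lia.
  by rewrite boundSS //; move: S5; clear; lia.
have [/existsP[[v w] /= /and4P[vS wS /eqP vw low]]|sat] :=
  boolP [exists vw : V * V, [&& vw.1 \in S, vw.2 \in S, vw.1 != vw.2 &
                        #|hit F vw.1 vw.2| + 2 < #|S|]].
  have [h1 _] := peel v w vS wS vw.
  have lt : #|F| < bound #|S|.
    rewrite (card_unhit F v w) bS -addnS leq_add //.
    by rewrite ltn_subRL addnC.
  by split=> [|_ FE]; [apply: ltnW | rewrite FE ltnn in lt].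
have hits v w : v \in S -> w \in S -> v <> w -> #|S| <= #|hit F v w| + 2.
  move=> vS wS /eqP vw; rewrite leqNgt; apply/negP => low; case/negP: sat.
  by apply/existsP; exists (v, w); rewrite /= vS wS vw.
case: (saturated_structure F3 FS noA noD hits S5) => [[v [w [k o0]]]|[B [BS B4 S5' FB]]].
  have vw := kernel_neq F3 k; have [vS wS] := kernel_in FS k.
  have hE := kernel_book AD k o0.
  have hc : #|hit F v w| = #|S| - 2.
    have [+ _] := kernel_hit F3 FS noA noD k (hits v w vS wS vw).
    by clear; lia.
  have [h1 h2] := peel v w vS wS vw; rewrite (card_unhit F v w) hc bS.
  split=> [|_ /eqP]; first by rewrite leq_add2r.
  rewrite eqn_add2r => /eqP /h2 ext.
  have -> : F = book [set v; w] (S :\: [set v; w]) :|: (F :\: hit F v w).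
    rewrite -hE; apply/setP=> t; rewrite in_setU in_setD.
    by have [|] := boolP (t \in hit F v w); rewrite // inE => /andP[->].
  have {1}-> : S = [set v; w] :|: S :\: [set v; w].
    rewrite -{1}(setID S [set v; w]) (setIidPr _) //.
    by rewrite subUset !sub1set vS wS.
  apply: Extremal_book => //; first by rewrite cards2; move/eqP: vw => ->.
  by rewrite disjoints_subset; apply/subsetP=> i; rewrite !inE => ->.
have FB' : F \subset triples B := AD_sub_triples AD FB.
have := subset_leq_card FB'; rewrite card_triples B4 S5' => F4.
split=> // _ FE; have /eqP/cards1P[u SBu] : #|S :\: B| = 1.
  by rewrite cardsD (setIidPr BS) B4 S5'.
have -> : F = triples B by apply/eqP; rewrite eqEcard FB' card_triples B4 FE.
have -> : S = u |: B by rewrite -SBu -{1}(setID S B) (setIidPr BS) setUC.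
apply: Extremal_block_point => //.
by have : u \in S :\: B by [rewrite SBu inE]; rewrite inE => /andP[].
Qed.

End Extremal.

(** * The extremal systems contain neither configuration *)

Section Construction.
Variable V : finType.
Implicit Types (S e : {set V}) (F : {set {set V}}).

Lemma uniq_edges_size (s : seq V) S : uniq s -> {subset s <= S} -> size s <= #|S|.
Proof. by move=> /card_uniqP <- sS; apply/subset_leq_card/subsetP. Qed.

Lemma AD_triples S : #|S| = 4 -> AD_system S (triples S).
Proof.
move=> S4; have in3 x y z : triple_in (triples S) x y z -> [/\ x \in S, y \in S & z \in S].
  by rewrite /triple_in inE !subUset !sub1set -!andbA => /and4P[].
split.
- by move=> t; rewrite inE => /andP[_ /eqP].
- by move=> t; rewrite inE => /andP[].
- move=> a b c x y z u /in3[aS bS xS] /in3[_ cS yS] /in3[_ _ zS].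
  suff : {subset [:: a; b; c; x; y; z] <= S} by move/(uniq_edges_size u); rewrite S4.
  move=> i; rewrite !inE; by do 5 (case/orP=> [/eqP->//|]); move/eqP->.
move=> a b c x y u /in3[aS bS cS] /in3[_ _ xS] /in3[_ _ yS].
suff : {subset [:: a; b; c; x; y] <= S} by move/(uniq_edges_size u); rewrite S4.
move=> i; rewrite !inE; by do 4 (case/orP=> [/eqP->//|]); move/eqP->.
Qed.

(** A triple that meets [e] contains [e], so all triples through a vertex of
    [e] share a second vertex of [e].  In A no two triples share two vertices.
    In D this excludes first the vertex of all three triples and then, as it
    is the only candidate for the second one, the two vertices of degree 2.
    Each triple is left with at most one vertex in [e], hence with none, and
    the copy lies in [F]. *)
Lemma AD_book e S F : #|e| = 2 -> [disjoint e & S] -> AD_system S F ->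
  AD_system (e :|: S) (book e S :|: F).
Proof.
move=> e2 eS [F3 FS noA noD].
have dis u : u \in e -> u \in S -> False by move=> ue uS; have := disjointFr eS ue; rewrite uS.
have bookE t : t \in book e S -> e \subset t by case/imsetP=> v _ ->; apply: subsetUr.
have partner u : u \in e -> exists u', [/\ u' \in e, u' <> u &
    forall t, t \in book e S :|: F -> u \in t -> u' \in t].
  move=> ue; have /card_gt0P[u'] : 0 < #|e :\ u| by have := cardsD1 u e; rewrite ue e2; clear; lia.
  rewrite !inE => /andP[/eqP u'u u'e]; exists u'; split=> // t.
  rewrite inE => /orP[/bookE/subsetP/(_ _ u'e)//|tF ut].
  by case: (dis u) => //; apply: (subsetP (FS t tF)).
have old t : t \in book e S :|: F -> (forall u, u \in t -> u \notin e) -> t \in F.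
  rewrite inE => /orP[/bookE/subsetP et|//] h.
  have /card_gt0P[u ue] : 0 < #|e| by rewrite e2.
  by have := h u (et u ue); rewrite ue.
have old3 x y z : triple_in (book e S :|: F) x y z ->
    x \notin e -> y \notin e -> z \notin e -> triple_in F x y z.
  by move=> h xe ye ze; apply: old => // u; rewrite !inE -orbA => /or3P[]/eqP->.
have in3 u x y z : triple_in (book e S :|: F) x y z -> u \in [:: x; y; z] ->
    u \in e -> exists u', [/\ u' \in e, u' <> u & u' \in [:: x; y; z]].
  move=> h uxyz ue; have [u' [u'e u'u /(_ _ h) h']] := partner u ue.
  exists u'; split=> //; move: uxyz h'; rewrite !inE -!orbA => ->.
  by apply.
split.
- move=> t; rewrite inE => /orP[/imsetP[v vS ->]|/F3//].
  by rewrite cardsU1 e2; case: (boolP (v \in e)) => // /dis /(_ vS).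
- move=> t; rewrite inE => /orP[/imsetP[v vS ->]|/FS tS].
    by rewrite subUset sub1set inE vS orbT subsetUl.
  exact: subset_trans tS (subsetUr _ _).
- move=> a b c x y z u e1 e2' e3.
  move: (u); rewrite /= !inE !negb_or -!andbA.
  case/and5P=> /eqP ab /eqP ac /eqP ax /eqP ay.
  case/and5P=> /eqP az /eqP bc /eqP bx /eqP by'.
  case/and5P=> /eqP bz /eqP cx /eqP cy /eqP cz.
  case/and4P=> /eqP xy /eqP xz /eqP yz _.
  (* Two triples that share only v cannot both contain the partner of v in e. *)
  have core v x1 y1 x2 y2 : v \in e -> triple_in (book e S :|: F) v x1 y1 ->
      triple_in (book e S :|: F) v x2 y2 -> x1 <> x2 -> x1 <> y2 -> y1 <> x2 -> y1 <> y2 -> False.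
    move=> ve h1 h2 *; have [v' [_ v'v h]] := partner v ve.
    have := h _ h1; have := h _ h2; rewrite !inE eqxx /= => /(_ isT) h3 /(_ isT) h4.
    move: h3 h4; rewrite -!orbA => /or3P[] /eqP h3 /or3P[] /eqP h4; congruence.
  have leaf v x1 y1 : triple_in (book e S :|: F) x1 y1 v -> x1 \notin e -> y1 \notin e -> v \notin e.
    move=> h x1e y1e; apply/negP=> ve; have [|v' [v'e v'v]] := in3 v _ _ _ h _ ve.
      by rewrite !inE eqxx !orbT.
    rewrite !inE => /or3P[] /eqP v'E //; first by rewrite -v'E v'e in x1e.
    by rewrite -v'E v'e in y1e.
  have ae : a \notin e by apply/negP => ae; apply: (core a b x c y) => //; congruence.
  have be : b \notin e.
    by apply/negP => be; apply: (core b a x c z) => //; try perm_edge; congruence.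
  have ce : c \notin e.
    by apply/negP => ce; apply: (core c a y b z) => //; try perm_edge; congruence.
  apply: (noA _ _ _ _ _ _ u); apply: old3 => //.
  + exact: (leaf x a b).
  + exact: (leaf y a c).
  exact: (leaf z b c).
move=> a b c x y u e1 e2' e3.
move: (u); rewrite /= !inE !negb_or -!andbA.
case/and5P=> /eqP ab /eqP ac /eqP ax /eqP ay.
case/and5P=> /eqP bc /eqP bx /eqP by' /eqP cx /and3P[/eqP cy /eqP xy _].
have leaf v x1 y1 : triple_in (book e S :|: F) x1 y1 v -> x1 \notin e -> y1 \notin e -> v \notin e.
  move=> h x1e y1e; apply/negP=> ve; have [|v' [v'e v'v]] := in3 v _ _ _ h _ ve.
    by rewrite !inE eqxx !orbT.
  rewrite !inE => /or3P[] /eqP v'E //; first by rewrite -v'E v'e in x1e.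
  by rewrite -v'E v'e in y1e.
have ce : c \notin e.
  apply/negP=> ce; have [v' [_ v'c h]] := partner c ce.
  move: (h _ e1) (h _ e2') (h _ e3); rewrite !inE !eqxx !orbT -!orbA.
  move=> /(_ isT) h1 /(_ isT) h2 /(_ isT) h3.
  by case/or3P: h1 => /eqP h1; case/or3P: h2 => /eqP h2; case/or3P: h3 => /eqP h3; congruence.
have mid v x1 y1 : v \in e -> triple_in (book e S :|: F) v c x1 -> triple_in (book e S :|: F) v c y1 ->
    x1 <> y1 -> False.
  move=> ve h1 h2 xy1; have [v' [v'e v'v h]] := partner v ve.
  move: (h _ h1) (h _ h2); rewrite !inE !eqxx -!orbA => /(_ isT) h3 /(_ isT) h4.
  have v'c : v' <> c by move=> v'c; rewrite -v'c v'e in ce.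
  by case/or3P: h3 => /eqP h3; case/or3P: h4 => /eqP h4; congruence.
have ae : a \notin e.
  by apply/negP=> ae; apply: (mid a b x) => //; perm_edge.
have be : b \notin e.
  by apply/negP=> be; apply: (mid b a y) => //; perm_edge.
apply: (noD _ _ _ _ _ u); apply: old3 => //.
  exact: (leaf x a c).
exact: (leaf y b c).
Qed.

Lemma extremal_AD S F : extremal S F -> AD_system S F.
Proof.
elim=> [u|{}S S4|{}S u S4 _|e {}S {}F e2 eS _ AD].
- by split=> [t|t|a b c x y z _|a b c x y _]; rewrite /triple_in inE.
- exact: AD_triples.
- apply: AD_systemW (AD_triples S4) => // t; rewrite inE => /andP[tS _].
  exact: subset_trans tS (subsetUr _ _).
exact: AD_book.
Qed.

Lemma card_book e S : [disjoint e & S] -> #|book e S| = #|S|.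
Proof.
move=> eS; apply: card_in_imset => v w vS wS vw.
have : v \in w |: e by rewrite -vw !inE eqxx.
by rewrite !inE => /orP[/eqP//|ve]; have := disjointFr eS ve; rewrite vS.
Qed.

Lemma extremal_card S F : extremal S F -> 0 < #|S| /\ #|F| = bound #|S|.
Proof.
elim=> [u|{}S S4|{}S u S4 uS|e {}S {}F e2 eS ext [S0 IH]].
- by rewrite cards0 cards1.
- by rewrite card_triples S4.
- by rewrite card_triples cardsU1 uS S4.
have eS0 : e :&: S = set0 by apply/eqP; rewrite setI_eq0.
rewrite cardsU e2 eS0 cards0 subn0; split; first by rewrite addSn.
rewrite [2 + _]/= boundSS // -IH addnC -(card_book eS) cardsU.
suff -> : book e S :&: F = set0 by rewrite cards0 subn0 addnC.
apply/setP=> t; rewrite !inE; apply/negP => /andP[/imsetP[v vS tE] tF].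
have /card_gt0P[u ue] : 0 < #|e| by rewrite e2.
have [_ /(_ _ tF) /subsetP tS _ _] := extremal_AD ext.
have := disjointFr eS ue; rewrite tS // tE !inE ue orbT //.
Qed.

(** Three points arise from one by adding a pair; four points are a block. *)
Lemma extremal_exists n S : #|S| = n -> odd n || (3 < n) -> exists F, extremal S F.
Proof.
elim/ltn_ind: n S => n IH S Sn h.
have [n1|n1] := eqVneq n 1.
  by move/eqP: Sn; rewrite n1 => /cards1P[u ->]; exists set0; apply: Extremal_point.
have [n4|n4] := eqVneq n 4; first by exists (triples S); apply: Extremal_block; rewrite Sn.
have [m nE] : exists m, n = m.+2 by case: n {IH Sn} h n1 n4 => [|[|m]] // *; exists m.
have hm : odd m || (3 < m).
  by move: h n4; rewrite nE; clear; lia.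
have /card_gt1P[u [v [uS vS uv]]] : 1 < #|S| by rewrite Sn nE.
have sub : [set u; v] \subset S by rewrite subUset !sub1set uS vS.
have Sm : #|S :\: [set u; v]| = m.
  by rewrite cardsD (setIidPr sub) cards2 uv Sn nE subSS subSS subn0.
have [|F ext] := IH m _ _ Sm hm; first by rewrite nE.
exists (book [set u; v] (S :\: [set u; v]) :|: F).
have -> : S = [set u; v] :|: S :\: [set u; v] by rewrite -{1}(setID S [set u; v]) (setIidPr sub).
rewrite setDUl setDv set0U setDDl setUid.
apply: Extremal_book => //; first by rewrite cards2 uv.
by rewrite disjoints_subset; apply/subsetP=> i; rewrite !inE => ->.
Qed.

End Construction.

(** * Containment of the configurations in terms of vertices *)

Section Configurations.
Variables (V : finType) (F : {set {set V}}).

Lemma imset_triple n (f : 'I_n.+1 -> V) i j k :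
  f @: triple i j k = [set f (inord i.-1); f (inord j.-1); f (inord k.-1)].
Proof. by rewrite /triple !imsetU !imset_set1. Qed.

Lemma contains_confA : contains F confA <-> exists a b c x y z,
  [/\ uniq [:: a; b; c; x; y; z], triple_in F a b x, triple_in F a c y & triple_in F b c z].
Proof.
split.
  case/existsP=> f /andP[/injectiveP f_inj /forall_inP h].
  exists (f (inord 0)), (f (inord 1)), (f (inord 2)).
  exists (f (inord 3)), (f (inord 4)), (f (inord 5)).
  split.
  - rewrite -[[:: _; _; _; _; _; _]]/(map f
      [:: inord 0; inord 1; inord 2; inord 3; inord 4; inord 5]).
    by rewrite map_inj_uniq //= !inE -!val_eqE /= !inordK.
  - by have := h (triple 1 2 4); rewrite imset_triple; apply; rewrite !inE eqxx.
  - by have := h (triple 1 3 5); rewrite imset_triple; apply; rewrite !inE eqxx ?orbT.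
  by have := h (triple 2 3 6); rewrite imset_triple; apply; rewrite !inE eqxx ?orbT.
case=> a [b [c [x [y [z [u e1 e2 e3]]]]]].
apply/existsP; exists [ffun i : 'I_6 => nth a [:: a; b; c; x; y; z] i].
apply/andP; split.
  apply/injectiveP => i j; rewrite !ffunE => /eqP.
  by rewrite nth_uniq //= => /eqP/val_inj.
apply/forall_inP => t; rewrite !inE -orbA => /or3P[] /eqP ->;
  by rewrite imset_triple !ffunE !inordK.
Qed.

Lemma contains_confD : contains F confD <-> exists a b c x y,
  [/\ uniq [:: a; b; c; x; y], triple_in F a b c, triple_in F a c x & triple_in F b c y].
Proof.
split.
  case/existsP=> f /andP[/injectiveP f_inj /forall_inP h].
  exists (f (inord 0)), (f (inord 1)), (f (inord 2)), (f (inord 3)), (f (inord 4)).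
  split.
  - rewrite -[[:: _; _; _; _; _]]/(map f
      [:: inord 0; inord 1; inord 2; inord 3; inord 4]).
    by rewrite map_inj_uniq //= !inE -!val_eqE /= !inordK.
  - by have := h (triple 1 2 3); rewrite imset_triple; apply; rewrite !inE eqxx.
  - by have := h (triple 1 3 4); rewrite imset_triple; apply; rewrite !inE eqxx ?orbT.
  by have := h (triple 2 3 5); rewrite imset_triple; apply; rewrite !inE eqxx ?orbT.
case=> a [b [c [x [y [u e1 e2 e3]]]]].
apply/existsP; exists [ffun i : 'I_5 => nth a [:: a; b; c; x; y] i].
apply/andP; split.
  apply/injectiveP => i j; rewrite !ffunE => /eqP.
  by rewrite nth_uniq //= => /eqP/val_inj.
apply/forall_inP => t; rewrite !inE -orbA => /or3P[] /eqP ->;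
  by rewrite imset_triple !ffunE !inordK.
Qed.

Lemma AD_systemP : AD_system [set: V] F <-> triple_system F /\ avoids F [:: confA; confD].
Proof.
rewrite /avoids /= andbT; split.
  case=> F3 _ noA noD; split; first by apply/forall_inP => t /F3 ->.
  apply/andP; split; apply/negP.
    by case/contains_confA=> a [b [c [x [y [z [u e1 e2 e3]]]]]]; apply: noA u _ _ _.
  by case/contains_confD=> a [b [c [x [y [u e1 e2 e3]]]]]; apply: noD u _ _ _.
case=> /forall_inP F3 /andP[/negP nA /negP nD]; split.
- by move=> t /F3/eqP.
- by move=> t _; apply: subsetT.
- by move=> a b c x y z u e1 e2 e3; apply/nA/contains_confA; exists a, b, c, x, y, z.
by move=> a b c x y u e1 e2 e3; apply/nD/contains_confD; exists a, b, c, x, y.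
Qed.

End Configurations.

Lemma ex_bound n : odd n || (3 < n) -> ex n [:: confA; confD] = bound n.
Proof.
move=> hn; apply/eqP; rewrite eqn_leq; apply/andP; split.
  apply/bigmax_leqP => F /andP[F3 av].
  have [] := @AD_extremal _ [set: 'I_n] F; rewrite ?cardsT ?card_ord //.
    by case: (n) hn.
  exact/AD_systemP.
have [||F ext] := @extremal_exists _ n [set: 'I_n] => //; first by rewrite cardsT card_ord.
have [_] := extremal_card ext; rewrite cardsT card_ord => <-.
by apply: leq_bigmax_cond; apply/andP/AD_systemP/extremal_AD.
Qed.

(** * From extremal systems to tournaments *)

Section Tournaments.
Variable V : finType.
Implicit Types (S e p q R : {set V}) (M F : {set {set V}}) (T : rel {set V}).

(** The vertices that complete [e] to a triple: those of the pairs dominated by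
    [e] and the unmatched one.  With it, the tournament construction relative
    to a vertex set [S] is a union of books over the matching. *)
Definition pages_of S M T e := \bigcup_(e' in M | T e e') e' :|: S :\: cover M.
Definition FT_on S M T := \bigcup_(e in M) book e (pages_of S M T e).

Lemma FT_onT M T : FT_on [set: V] M T = FT M T.
Proof.
rewrite /FT_on /pages_of setTD; apply/setP=> t; apply/bigcupP/idP.
  case=> e eM /imsetP[v]; rewrite inE => /orP[vT|vM] ->.
    by rewrite inE; apply/orP; left; apply/imset2P; exists e v.
  by rewrite inE; apply/orP; right; apply/imset2P; exists e v.
rewrite inE => /orP[]/imset2P[e v eM vT ->]; exists e => //;
  by apply: imset_f; rewrite inE vT ?orbT.
Qed.

(** On the full vertex set, this says that the matching has maximum size
    ([matching_onT]); it is stable under the addition of a pair. *)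
Definition matching_on S M := [/\ {in M, forall e, #|e| = 2}, trivIset M,
  cover M \subset S & #|S :\: cover M| <= 1].

Lemma card_cover_pairs M : {in M, forall e, #|e| = 2} -> trivIset M -> #|cover M| = 2 * #|M|.
Proof.
move=> M2 /eqP <-; rewrite (eq_bigr (fun=> 2)); last by move=> e; apply: M2.
by rewrite sum_nat_const mulnC.
Qed.

Lemma matching_onT M : matching_on [set: V] M -> maximum_matching M.
Proof.
case=> M2 tM _; rewrite setTD => le1; split=> //.
have := cardsC (cover M); rewrite card_cover_pairs //.
by move: le1; clear; lia.
Qed.

(** Adds [e] as a source; values at pairs other than [e] are kept. *)
Definition extend T e : rel {set V} := fun a b =>
  if a == e then b != e else (b != e) && T a b.

Section Extend.
Variables (S e : {set V}) (M : {set {set V}}) (T : rel {set V}).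
Hypothesis e2 : #|e| = 2.
Hypothesis eS : [disjoint e & S].
Hypothesis MS : matching_on S M.
Hypothesis TM : transitive_tournament M T.

Lemma extend_notin : e \notin M.
Proof.
apply/negP=> eM; have /card_gt0P[u ue] : 0 < #|e| by rewrite e2.
have [_ _ /subsetP sub _] := MS; have := disjointFr eS ue.
by rewrite sub //; apply/bigcupP; exists e.
Qed.

Lemma extend_neq a : a \in M -> (a == e) = false.
Proof. by move=> aM; apply/negP => /eqP ae; case/negP: extend_notin; rewrite -ae. Qed.

Lemma extend_cover : cover (e |: M) = e :|: cover M.
Proof. by rewrite /cover big_setU1 ?extend_notin. Qed.

Lemma extend_unmatched : (e :|: S) :\: cover (e |: M) = S :\: cover M.
Proof.
rewrite extend_cover; apply/setP=> i; rewrite !inE.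
by have [/(disjointFr eS)->|] := boolP (i \in e); rewrite ?andbF.
Qed.

Lemma extend_matching : matching_on (e :|: S) (e |: M).
Proof.
have [M2 tM sub le1] := MS; split.
- by move=> a; rewrite !inE => /orP[/eqP->//|/M2].
- rewrite /trivIset extend_cover big_setU1 ?extend_notin //= (eqP tM).
  rewrite cardsU; suff -> : e :&: cover M = set0 by rewrite cards0 subn0.
  by apply/eqP; rewrite setI_eq0; apply: disjointWr sub eS.
- by rewrite extend_cover setUS.
by rewrite extend_unmatched.
Qed.

Lemma extend_tournament : transitive_tournament (e |: M) (extend T e).
Proof.
have [[irr tot] tr] := TM; split; first split.
- move=> a; rewrite !inE /extend => /orP[/eqP->|aM]; first by rewrite eqxx.
  by rewrite extend_neq //= irr.
- move=> a b; rewrite !inE /extend => /orP[/eqP->|aM] /orP[/eqP->|bM].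
  + by rewrite eqxx.
  + by rewrite eqxx extend_neq.
  + by rewrite eqxx extend_neq.
  by rewrite !extend_neq //=; apply: tot.
move=> b a c; rewrite !inE /extend => /orP[/eqP->|bM] /orP[/eqP->|aM] /orP[/eqP->|cM];
  rewrite ?eqxx ?extend_neq //=.
exact: tr.
Qed.

Lemma extend_beaten a : a \in M ->
  [set b in e |: M | extend T e a b] = [set b in M | T a b].
Proof.
move=> aM; apply/setP=> b; rewrite !inE /extend (extend_neq aM).
by have [->|] //= := eqVneq b e; rewrite (negbTE extend_notin).
Qed.

Lemma extend_outdeg a : a \in M -> outdeg (e |: M) (extend T e) a = outdeg M T a.
Proof. by move=> aM; rewrite /outdeg extend_beaten. Qed.

Lemma extend_beaten_top : [set b in e |: M | extend T e e b] = M.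
Proof.
apply/setP=> b; rewrite !inE /extend eqxx.
have [->|] := eqVneq b e; first by rewrite (negbTE extend_notin).
by rewrite andbT.
Qed.

Lemma extend_outdeg_top : outdeg (e |: M) (extend T e) e = #|M|.
Proof. by rewrite /outdeg extend_beaten_top. Qed.

Lemma outdeg_lt a : a \in M -> outdeg M T a < #|M|.
Proof.
move=> aM; have [[irr _] _] := TM; apply: proper_card; apply/properP; split.
  by apply/subsetP=> b; rewrite inE => /andP[].
by exists a; rewrite // inE irr ?andbF.
Qed.

(** The new source dominates all old pairs, so its book has all of [S] as
    pages, and the books of the old pairs are unchanged. *)
Lemma extend_FT : FT_on (e :|: S) (e |: M) (extend T e) = book e S :|: FT_on S M T.
Proof.
have big a : \bigcup_(b in e |: M | extend T e a b) b = cover [set b in e |: M | extend T e a b].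
  by apply: eq_bigl => b; rewrite [in RHS]inE.
rewrite /FT_on big_setU1 ?extend_notin //=; congr (book e _ :|: _).
  rewrite /pages_of big extend_beaten_top extend_unmatched.
  by have [_ _ sub _] := MS; rewrite -[RHS](setID S (cover M)) (setIidPr sub).
apply: eq_bigr => a aM; rewrite /pages_of big extend_beaten // extend_unmatched.
by congr (book a (_ :|: _)); apply: eq_bigl => b; rewrite inE.
Qed.

Lemma extend_two_lowest p q : two_lowest M T p q ->
  two_lowest (e |: M) (extend T e) p q.
Proof.
case=> pM qM pq lp lq; split=> //; try by rewrite !inE ?pM ?qM orbT.
- move=> a; rewrite !inE => /andP[ap /orP[/eqP->|aM]].
    by rewrite extend_outdeg_top extend_outdeg // outdeg_lt.
  by rewrite !extend_outdeg //; apply: lp; rewrite !inE ap.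
move=> a; rewrite !inE => /andP[apq /orP[/eqP->|aM]].
  by rewrite extend_outdeg_top extend_outdeg // outdeg_lt.
by rewrite !extend_outdeg //; apply: lq; rewrite !inE apq.
Qed.

End Extend.

(** The three forms of the theorem relative to [S], recorded together with the
    parity of [S], which separates the second form from the others. *)
Definition form_on S F := exists M T,
  [/\ matching_on S M, transitive_tournament M T &
  [\/ odd #|S| /\ F = FT_on S M T,
      ~~ odd #|S| /\ exists p q, two_lowest M T p q /\ F = FT_on S M T :|: book p q |
      odd #|S| /\ exists u p q, [/\ u \in S :\: cover M, two_lowest M T p q &
        F = (FT_on S M T :\: [set u |: p; u |: q]) :|: book p q]]].

Lemma form_book e S F : #|e| = 2 -> [disjoint e & S] -> form_on S F ->
  form_on (e :|: S) (book e S :|: F).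
Proof.
move=> e2 eS [M [T [MS TM h]]]; exists (e |: M), (extend T e).
have odE : odd #|e :|: S| = odd #|S|.
  have -> : #|e :|: S| = 2 + #|S|.
    by rewrite cardsU e2; move: eS; rewrite -setI_eq0 => /eqP->; rewrite cards0 subn0.
  by rewrite oddD.
have [M2 tM sub _] := MS.
split; [exact: extend_matching | exact: (extend_tournament e2 eS MS TM) | rewrite odE extend_FT //].
case: h => [[od ->]|[od [p [q [low ->]]]]|[od [u [p [q [uS low ->]]]]]].
- exact: Or31.
- apply: Or32; split=> //; exists p, q; split; first exact: (extend_two_lowest e2 eS MS TM low).
  by rewrite setUA.
apply: Or33; split=> //; exists u, p, q; split.
- by rewrite extend_unmatched.
- exact: (extend_two_lowest e2 eS MS TM low).
rewrite setDUl setUA; congr (_ :|: _ :|: _); apply/esym/setDidPl.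
have [pM qM _ _ _] := low; have uS' : u \in S by move: uS; rewrite inE => /andP[].
have noe r : r \in M -> (u |: r) \notin book e S.
  move=> rM; apply/imsetP=> -[v _ uv].
  have /card_gt0P[w we] : 0 < #|e| by rewrite e2.
  have : w \in u |: r by rewrite uv !inE we orbT.
  have wS := disjointFr eS we; rewrite !inE => /orP[/eqP wu|wr].
    by rewrite wu uS' in wS.
  by rewrite (subsetP sub) // in wS; apply/bigcupP; exists r.
by rewrite disjoint_sym disjoints_subset subUset !sub1set !inE !noe.
Qed.

Lemma set1_matching p : #|p| = 2 ->
  [/\ {in [set p], forall e : {set V}, #|e| = 2}, trivIset [set p] & cover [set p] = p].
Proof.
move=> p2; split.
- by move=> e; rewrite inE => /eqP->.
- by rewrite /trivIset /cover !big_set1.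
by rewrite /cover big_set1.
Qed.

Definition no_arc : rel {set V} := fun _ _ => false.

Lemma no_arc_tournament p : transitive_tournament [set p] no_arc.
Proof.
split=> //; split=> // a b; rewrite !inE => /eqP-> /eqP->; by rewrite eqxx.
Qed.

Lemma base_two_lowest p q : #|p| = 2 -> #|q| = 2 -> [disjoint q & p] -> q \notin [set p] ->
  two_lowest (q |: [set p]) (extend no_arc q) p q.
Proof.
move=> p2 q2 qp nq; have pq : p != q by rewrite inE eq_sym in nq.
have o a b : extend no_arc q a b = (a == q) && (b != q) by rewrite /extend /no_arc andbF; case: eqP.
split; rewrite ?inE ?eqxx ?orbT //.
  move=> a; rewrite !inE => /andP[ap]; rewrite (negbTE ap) orbF => /eqP->.
  rewrite /outdeg [X in X < _](_ : _ = 0).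
    by apply/card_gt0P; exists p; rewrite !inE o !eqxx orbT pq.
  apply/eqP; rewrite cards_eq0; apply/eqP/setP=> b; rewrite !inE o (negbTE pq).
  by rewrite andbF.
by move=> a; rewrite !inE; case: (a == p); case: (a == q).
Qed.

(** Both sides have four elements. *)
Lemma triples_pairs p q : #|p| = 2 -> #|q| = 2 -> [disjoint q & p] ->
  triples (q :|: p) = book q p :|: book p q.
Proof.
move=> p2 q2 qp; apply/eqP; rewrite eq_sym eqEcard; apply/andP; split.
  rewrite subUset; apply/andP; split; apply/subsetP => t /imsetP[v v1 ->]; rewrite inE cardsU1.
    rewrite q2 (disjointFl qp v1) subUset subsetUl sub1set inE v1 orbT //.
  by rewrite p2 (disjointFr qp v1) subUset subsetUr sub1set inE v1.
have q0 : q :&: p = set0 by apply/eqP; rewrite setI_eq0.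
rewrite card_triples cardsU p2 q2 q0 cards0 cardsU !card_book // 1?disjoint_sym // p2 q2.
rewrite (_ : _ :&: _ = set0) ?cards0 //.
apply/setP=> t; rewrite [in RHS]inE; apply/negP.
rewrite inE => /andP[/imsetP[v vp tq] /imsetP[w wq tp]].
have : #|q :|: p| <= #|t|.
  apply: subset_leq_card; rewrite subUset {1}tq tp.
  by rewrite subsetUr /= -tp tp subsetUr.
by rewrite cardsU p2 q2 q0 cards0 tp cardsU1 p2; case: (_ \notin _).
Qed.

Lemma split_pairs S : #|S| = 4 -> exists p q,
  [/\ #|p| = 2, #|q| = 2, [disjoint q & p] & S = q :|: p].
Proof.
move=> S4; have /card_gt1P[a [b [aS bS ab]]] : 1 < #|S| by rewrite S4.
have sub : [set a; b] \subset S by rewrite subUset !sub1set aS bS.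
exists (S :\: [set a; b]), [set a; b]; split.
- by rewrite cardsD (setIidPr sub) S4 cards2 ab.
- by rewrite cards2 ab.
- by rewrite disjoints_subset; apply/subsetP=> i; rewrite !inE => ->.
by rewrite -{1}(setID S [set a; b]) (setIidPr sub).
Qed.

(** The two lowest pairs with the set [R] of unmatched vertices, the common
    starting point of the two forms that are modified at the bottom. *)
Lemma form_base p q R : #|p| = 2 -> #|q| = 2 -> [disjoint q & p :|: R] -> [disjoint p & R] ->
  #|R| <= 1 ->
  [/\ matching_on (q :|: (p :|: R)) (q |: [set p]),
      transitive_tournament (q |: [set p]) (extend no_arc q),
      two_lowest (q |: [set p]) (extend no_arc q) p q,
      (q :|: (p :|: R)) :\: cover (q |: [set p]) = R &
      FT_on (q :|: (p :|: R)) (q |: [set p]) (extend no_arc q) =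
        book q (p :|: R) :|: book p R].
Proof.
move=> p2 q2 qpR pR R1; have [c2 tp cp] := set1_matching p2.
have pRE : (p :|: R) :\: cover [set p] = R.
  rewrite cp; apply/setP=> i; rewrite !inE.
  by have [/(disjointFr pR)|] := boolP (i \in p).
have MS : matching_on (p :|: R) [set p] by split; rewrite // ?pRE ?cp // subsetUl.
have TM := no_arc_tournament p.
split.
- exact: extend_matching.
- exact: (extend_tournament q2 qpR MS TM).
- apply: base_two_lowest => //; first exact: disjointWr (subsetUl _ _) qpR.
  exact: (extend_notin q2 qpR MS).
- by rewrite (extend_unmatched q2 qpR MS).
rewrite (extend_FT _ q2 qpR MS) /FT_on big_set1 /pages_of pRE.
by rewrite big_pred0 ?set0U // => b; rewrite andbF.
Qed.

Lemma extremal_form S F : extremal S F -> form_on S F.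
Proof.
elim=> [u|{}S S4|{}S u S4 uS|e {}S {}F e2 eS _]; last exact: form_book.
- exists set0, no_arc; split.
  + split; rewrite /trivIset /cover ?big_set0 ?sub0set ?cards0 ?setD0 ?cards1 //.
    by move=> e; rewrite inE.
  + by split; [split|] => // a; rewrite inE.
  by apply: Or31; rewrite cards1 /FT_on big_set0.
- have [p [q [p2 q2 qp ->]]] := split_pairs S4.
  have [||| MS TM low _ FTE] := @form_base p q set0 p2 q2; rewrite ?setU0 ?cards0 //.
    by rewrite disjoints_subset setC0 subsetT.
  exists (q |: [set p]), (extend no_arc q); rewrite setU0 in MS FTE; split=> //.
  apply: Or32; split.
    by rewrite cardsU p2 q2; move: qp; rewrite -setI_eq0 => /eqP->; rewrite cards0.
  exists p, q; split=> //; rewrite FTE triples_pairs // /book imset0 ?setU0 //.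
have [p [q [p2 q2 qp SE]]] := split_pairs S4.
have [uq up] : u \notin q /\ u \notin p by move: uS; rewrite SE inE negb_or => /andP.
have od : odd #|u |: S| by rewrite cardsU1 uS S4.
have qpu : [disjoint q & p :|: [set u]].
  rewrite disjoints_subset; apply/subsetP=> i iq.
  by rewrite !inE negb_or (disjointFr qp iq) /=; apply: contraNneq uq => <-.
have pu : [disjoint p & [set u]] by rewrite disjoint_sym disjoints1.
have [|MS TM low un FTE] := @form_base p q [set u] p2 q2 qpu pu; first by rewrite cards1.
have uSE : u |: S = q :|: (p :|: [set u]) by rewrite SE setUC setUA.
rewrite uSE in od *; exists (q |: [set p]), (extend no_arc q); split=> //.
apply: Or33; split=> //; exists u, p, q; split=> //; first by rewrite un inE.
(* Removing the triples of u from the two books leaves the triples on q and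
   one vertex of p; the added ones complete the block on p and q. *)
rewrite FTE SE triples_pairs // /book imsetU !imset_set1 -!/(book _ _); congr (_ :|: _).
apply/setP=> t; rewrite !inE.
have [tb|_] := boolP (t \in book q p); last by case: (t == u |: q); case: (t == u |: p).
have ut : u \notin t.
  case/imsetP: tb => v vp ->; rewrite !inE negb_or uq andbT.
  by apply: contraNneq up => ->.
by rewrite andbT negb_or; apply/esym/andP; split;
  apply: contraNneq ut => ->; rewrite !inE eqxx.
Qed.

Lemma form_onT F : form_on [set: V] F ->
  if odd #|V| then of_form_FT F \/ of_form_FT_pm F else of_form_FT_plus F.
Proof.
case=> M [T [MS TM]]; rewrite cardsT FT_onT; have MM := matching_onT MS.
case=> [[od FE]|[od [p [q [low FE]]]]|[od [u [p [q [uM low FE]]]]]].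
- by rewrite od; left; exists M, T.
- by rewrite (negbTE od); exists M, T, p, q.
by rewrite od; right; exists M, T, u, p, q; split=> //; move: uM; rewrite !inE andbT.
Qed.

(** * The sizes of the tournament constructions *)

Section Count.
Variables (M : {set {set V}}) (T : rel {set V}).
Hypothesis MM : maximum_matching M.
Hypothesis TM : tournament M T.

Let tops a := pages_of [set: V] M T a.

Lemma matching_disjoint a b x : a \in M -> b \in M -> x \in a -> x \in b -> a = b.
Proof.
case: MM => _ /trivIsetP tM _ aM bM xa xb; apply/eqP/negPn/negP => ab.
by have := disjointFr (tM _ _ aM bM ab) xa; rewrite xb.
Qed.

Lemma matched_cover a x : a \in M -> x \in a -> x \in cover M.
Proof. by move=> aM xa; apply/bigcupP; exists a. Qed.

Lemma pages_disjoint a : a \in M -> [disjoint a & tops a].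
Proof.
move=> aM; have [irr _] := TM; rewrite disjoints_subset; apply/subsetP => x xa.
rewrite !inE (matched_cover aM xa) /= orbF; apply/bigcupP => -[b /andP[bM Tab] xb].
by move: Tab; rewrite (matching_disjoint aM bM xa xb) irr.
Qed.

Lemma card_pages a : a \in M -> #|tops a| = 2 * outdeg M T a + (#|V| - 2 * #|M|).
Proof.
move=> aM; have [M2 tM _] := MM; rewrite /tops /pages_of setTD.
set A := \bigcup_(b in M | T a b) b.
have AE : A = cover [set b in M | T a b] by apply: eq_bigl => b; rewrite inE.
have sub : [set b in M | T a b] \subset M by apply/subsetP=> b; rewrite inE => /andP[].
rewrite cardsU (_ : A :&: _ = set0) ?cards0 ?subn0; last first.
  apply/eqP; rewrite setI_eq0 disjoint_sym disjoints_subset; apply/subsetP=> x.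
  rewrite !inE; apply: contra => /bigcupP[b /andP[bM _]]; exact: matched_cover.
rewrite [#|~: cover M|]cardsCs setCK -(card_cover_pairs M2 tM) AE card_cover_pairs //.
  by move=> b /(subsetP sub)/M2.
exact: trivIsetS sub tM.
Qed.

(** Each pair of distinct members of [M] carries exactly one arc. *)
Lemma outdeg_sum : 2 * \sum_(a in M) outdeg M T a = #|M| * (#|M| - 1).
Proof.
have [irr tot] := TM.
have oE a : outdeg M T a = \sum_(b in M) T a b.
  by rewrite /outdeg -sum1dep_card big_mkcondr; apply: eq_bigr => b _; case: (T a b).
under eq_bigr => a _ do rewrite oE.
rewrite mul2n -addnn; rewrite [X in _ + X]exchange_big -big_split /=.
rewrite -sum_nat_const; apply: eq_bigr => a aM; rewrite -big_split /=.
rewrite (bigD1 a) //= irr // add0n (cardsD1 a M) aM add1n subSS subn0 -sum1_card.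
rewrite (eq_bigl (mem (M :\ a))); last by move=> b; rewrite !inE andbC.
apply: eq_bigr => b; rewrite !inE => /andP[ba bM]; rewrite eq_sym in ba.
by have := tot a b aM bM ba; case: (T a b); case: (T b a).
Qed.

(** Distinct members of [M] are disjoint, so a triple has no room for two. *)
Lemma book_inj a b v w : a \in M -> b \in M -> v |: a = w |: b -> a = b.
Proof.
have [M2 /trivIsetP tM _] := MM; move=> aM bM vw; apply/eqP/negPn/negP => ab.
have ab0 : a :&: b = set0 by apply/eqP; rewrite setI_eq0; apply: tM.
have : #|a :|: b| <= #|v |: a|.
  by apply: subset_leq_card; rewrite subUset subsetUr vw subsetUr.
by rewrite cardsU ab0 cards0 M2 // M2 // cardsU1 M2 //; case: (_ \notin _).
Qed.

Lemma FT_card : #|FT M T| = #|M| * (#|M| - 1) + #|M| * (#|V| - 2 * #|M|).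
Proof.
rewrite -FT_onT /FT_on.
have -> : #|\bigcup_(a in M) book a (tops a)| = \sum_(a in M) #|book a (tops a)|.
  have dis a b t : a \in M -> b \in M -> t \in book a (tops a) -> t \in book b (tops b) -> a = b.
    by move=> aM bM /imsetP[v _ ->] /imsetP[w _]; apply: book_inj.
  under [RHS]eq_bigr => a _ do rewrite -sum1_card.
  rewrite (exchange_big_dep (mem (\bigcup_(a in M) book a (tops a)))) /=; last first.
    by move=> a t aM ta; apply/bigcupP; exists a.
  rewrite -sum1_card; apply: eq_bigr => t /bigcupP[a aM ta].
  rewrite (big_pred1 a) // => b /=; apply/andP/eqP => [[bM tb]|->//].
  exact: dis bM aM tb ta.
rewrite (eq_bigr (fun a => 2 * outdeg M T a + (#|V| - 2 * #|M|))); last first.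
  by move=> a aM; rewrite card_book ?card_pages // pages_disjoint.
by rewrite big_split /= -big_distrr /= outdeg_sum sum_nat_const.
Qed.

(** A triple of both families would require the arc from [p] to [q].  By
    transitivity [p] would then dominate whatever [q] dominates, although its
    outdegree is smaller. *)
Lemma FT_book_disjoint p q : two_lowest M T p q -> {in M & &, transitive T} ->
  [disjoint FT M T & book p q].
Proof.
case=> pM qM pq lp _ tr; have [irr tot] := TM.
have Tpq : ~~ T p q.
  apply/negP=> Tpq; have := lp q; rewrite !inE eq_sym pq qM => /(_ isT).
  rewrite ltnNge => /negP; apply.
  apply/subset_leq_card/subsetP => b; rewrite !inE => /andP[bM Tqb].
  by rewrite bM; apply: (tr q).
rewrite disjoint_sym disjoints_subset; apply/subsetP=> t /imsetP[v vq ->].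
rewrite inE -FT_onT; apply/negP=> /bigcupP[a aM /imsetP[w wa e]].
have pa := book_inj pM aM e; subst a.
have vp : v \notin p by apply/negP=> vp; case/eqP: pq; apply: matching_disjoint vp vq.
have vw : v = w.
  have : v \in w |: p by rewrite -e !inE eqxx.
  by rewrite !inE (negbTE vp) orbF => /eqP.
move: wa; rewrite -vw !inE (matched_cover qM vq) orbF => /bigcupP[b /andP[bM Tpb] vb].
by case/negP: Tpq; rewrite (matching_disjoint qM bM vq vb).
Qed.

Lemma card_low_book p q : two_lowest M T p q -> #|book p q| = 2.
Proof.
case=> pM qM pq _ _; have [M2 /trivIsetP tM _] := MM.
by rewrite card_book ?M2 // tM.
Qed.

End Count.

Lemma half_square n : n./2 * (n./2 - 1) + n./2 * (n - 2 * n./2) = (n - 1) ^ 2 %/ 4.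
Proof.
move: (odd_double_half n); move: n./2 (odd n) => m [] /= <-.
  have -> : (1 + m.*2 - 1) ^ 2 = m * m * 4 by clear; nia.
  by rewrite mulnK //; case: m => [|m]; clear; nia.
case: m => [|m] //.
have -> : (0 + m.+1.*2 - 1) ^ 2 = (m.+1 * m) * 4 + 1 by clear; nia.
by rewrite divnMDl //; clear; nia.
Qed.

Lemma FT_plus_card F : ~~ odd #|V| -> of_form_FT_plus F -> #|F| = bound #|V|.
Proof.
move=> od [M [T [p [q [MM [TM tr] low ->]]]]].
have d := FT_book_disjoint MM TM low tr.
have d0 : FT M T :&: book p q = set0 by apply/eqP; rewrite setI_eq0.
rewrite /FT_plus -/(book p q) cardsU d0 cards0 subn0 (card_low_book MM low) FT_card //.
have [_ _ ->] := MM; by rewrite half_square /bound (negbTE od).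
Qed.

Lemma FT_card_odd M T : odd #|V| -> maximum_matching M -> tournament M T -> #|FT M T| = bound #|V|.
Proof.
move=> od MM TM; rewrite FT_card //; have [_ _ ->] := MM; by rewrite half_square /bound od addn0.
Qed.

Lemma FT_pm_card F : odd #|V| -> of_form_FT_pm F -> #|F| = bound #|V|.
Proof.
move=> od [M [T [u [p [q [MM [TM tr] uM low ->]]]]]].
have [pM qM pq _ _] := low; have d := FT_book_disjoint MM TM low tr.
have inFT r : r \in M -> u |: r \in FT M T.
  by move=> rM; rewrite inE; apply/orP; right; apply/imset2P; exists r u; rewrite // inE.
have sub : [set u |: p; u |: q] \subset FT M T by rewrite subUset !sub1set !inFT.
have upq : u |: p != u |: q.
  by apply/eqP => e; case/eqP: pq; apply: (book_inj MM pM qM e).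
have d0 : (FT M T :\: [set u |: p; u |: q]) :&: book p q = set0.
  by apply/eqP; rewrite setI_eq0; apply: disjointWl d; apply: subsetDl.
rewrite /FT_pm -/(book p q) cardsU d0 cards0 subn0 (card_low_book MM low).
rewrite cardsD (setIidPr sub) cards2 upq subnK ?(FT_card_odd od MM TM) //.
by rewrite -(FT_card_odd od MM TM) -[X in X <= _]/((true).+1) -upq -cards2; apply: subset_leq_card.
Qed.

End Tournaments.

(** * The extremal number and the extremal systems *)

Theorem theorem10 (n : nat) :
  [/\ 4 <= n -> ~~ odd n ->
        ex n [:: confA; confD] = (n - 1) ^ 2 %/ 4 + 2,
      odd n ->
        ex n [:: confA; confD] = (n - 1) ^ 2 %/ 4 &
      forall (V : finType) (F : {set {set V}}),
        #|V| = n -> triple_system F -> avoids F [:: confA; confD] ->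
        (4 <= n -> ~~ odd n ->
          (#|F| = ex n [:: confA; confD] <-> of_form_FT_plus F)) /\
        (5 <= n -> odd n ->
          (#|F| = ex n [:: confA; confD] <->
             of_form_FT F \/ of_form_FT_pm F))].
Proof.
split=> [n4 od|od|V F Vn F3 av].
- by rewrite ex_bound ?n4 ?orbT // /bound (negbTE od).
- by rewrite ex_bound ?od // /bound od addn0.
have AD : AD_system [set: V] F by apply/AD_systemP.
have form : 3 < n -> #|F| = bound n ->
    if odd #|V| then of_form_FT F \/ of_form_FT_pm F else of_form_FT_plus F.
  move=> n4 FE; apply/form_onT/extremal_form.
  have V4 : 3 < #|[set: V]| by rewrite cardsT Vn.
  have [_] := AD_extremal (ltn_trans (isT : 0 < 3) V4) AD.
  by rewrite cardsT Vn; apply=> //; apply: ltnW.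
split=> n4 od; rewrite ex_bound ?od ?n4 ?orbT //; split.
- by move=> FE; have := form n4 FE; rewrite Vn (negbTE od).
- by rewrite -Vn; apply: FT_plus_card; rewrite Vn.
- by move=> FE; have := form (ltnW n4) FE; rewrite Vn od.
rewrite -Vn; case=> [[M [T [MM [TM _] ->]]]|]; first by apply: FT_card_odd; rewrite ?Vn.
by apply: FT_pm_card; rewrite Vn.
Qed.
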